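(* Let $(M^{2n+1},\eta)$ be a contact manifold ($n\geq 1$), and let $(\phi,\xi,\eta,g)$ be an almost contact metric structure on $M$ (with the same $1$-form $\eta$). Let $\nabla$ be the Levi-Civita connection of $g$, let $A=\nabla\xi:TM\to TM$, $X\mapsto\nabla_X\xi$, and let $D=\ker\eta$. Assume that $$A\phi+\phi A=0$$ and $$g((\nabla_X\phi)Y,Z)=0\quad\text{for all } X,Y,Z\in D.$$ Suppose there exist $p\in M$ and $c\in\mathbb{R}$ such that the sectional curvature of $g$ satisfies $K_p(\pi)=c$ for each $2$-plane $\pi$ of $D_p$. Then $\dim M=5$. Moreover, $A_p:D_p\to D_p$ is an isomorphism if and only if $c\neq 0$.
   Context: A contact manifold $(M^{2n+1},\eta)$ is a smooth manifold of dimension $2n+1$ with a $1$-form $\eta$ such that $\eta\wedge(d\eta)^n\neq 0$ everywhere. Its contact distribution is $D=\ker\eta\subset TM$, with fiber $D_p$ at $p$; $X\in D$ means that $X$ is a section of $D$. An almost contact metric structure $(\phi,\xi,\eta,g)$ on $M^{2n+1}$ consists of a $(1,1)$-tensor field $\phi$, a vector field $\xi$, a $1$-form $\eta$ and a Riemannian metric $g$ with $\phi^2=-I+\eta\otimes\xi$, $\eta(\xi)=1$ and $g(\phi X,\phi Y)=g(X,Y)-\eta(X)\eta(Y)$ for all $X,Y$. Consequently $\phi\xi=0$, $\eta\circ\phi=0$ and $\eta(X)=g(X,\xi)$. It is not assumed that $d\eta(X,Y)=g(X,\phi Y)$, nor that $\xi$ is the Reeb vector field of $\eta$. Since $\xi$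 has unit length, $A$ takes values in $D$, so $A_p$ restricts to an endomorphism of $D_p$. *)

(* Defs.v *)
From HB Require Import structures.
From mathcomp Require Import all_boot all_order all_algebra all_fingroup.
From mathcomp Require Import all_classical all_reals all_analysis.

Set Implicit Arguments.
Unset Strict Implicit.
Unset Printing Implicit Defensive.

Import Order.TTheory GRing.Theory Num.Theory.
Import numFieldNormedType.Exports.

Local Open Scope classical_set_scope.
Local Open Scope ring_scope.

Section Smooth.
Context {R : realType} {V W : normedModType R}.

(* Meant for U open and V finite-dimensional. *)
Fixpoint Ck (k : nat) (U : set V) (f : V -> W) : Prop :=
  match k with
  | 0 => forall x, U x -> {for x, continuous f}
  | k'.+1 => (forall x, U x -> differentiable f x) /\
             (forall v, Ck k' U (fun x => 'd f x v))
  end.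

Definition smooth (U : set V) (f : V -> W) : Prop := forall k, Ck k U f.

End Smooth.

Section Forms.
Context {R : realType} {V : Type}.

Definition kform (k : nat) := ('I_k -> V) -> R.

(* Normalized so that (dx_1 /\ ... /\ dx_k)(e_1, ..., e_k) = 1. *)
Definition wedge (k l : nat) (a : kform k) (b : kform l) : kform (k + l) :=
  fun v => (k`!%:R * l`!%:R)^-1 *
    \sum_(s : 'S_(k + l)) (-1) ^+ s
      * a (fun i => v (s (lshift l i))) * b (fun j => v (s (rshift k j))).

Fixpoint wedge_power (b : kform 2) (n : nat) : kform (n * 2) :=
  match n with
  | 0 => fun _ => 1
  | n'.+1 => wedge b (@wedge_power b n')
  end.

Definition form1 (a : V -> R) : kform 1 := fun v => a (v ord0).
Definition form2 (b : V -> V -> R) : kform 2 := fun v => b (v ord0) (v ord_max).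

End Forms.

Arguments wedge_power {R V} b n v.

(* A smooth manifold given by a smooth atlas. [chart_at] selects one chart
   around each point; it plays no role other than to provide a concrete model
   of the tangent spaces, see below. *)
Record manifold (R : realType) (m : nat) := Manifold {
  carrier :> topologicalType;
  manifold_hausdorff : hausdorff_space carrier;
  manifold_second_countable : @second_countable carrier;
  chart : Type;
  chart_dom : chart -> set carrier;
  chart_map : chart -> carrier -> 'rV[R]_m;
  chart_inv : chart -> 'rV[R]_m -> carrier;
  chart_dom_open : forall c, open (chart_dom c);
  chart_map_open : forall c, open (chart_map c @` chart_dom c);
  chart_mapK : forall c p, chart_dom c p -> chart_inv c (chart_map c p) = p;
  chart_map_continuous : forall c, {within chart_dom c, continuous (chart_map c)};
  chart_inv_continuous :
    forall c, {within chart_map c @` chart_dom c, continuous (chart_inv c)};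
  transition_smooth : forall c d,
    smooth (chart_map c @` (chart_dom c `&` chart_dom d)) (chart_map d \o chart_inv c);
  chart_at : carrier -> chart;
  chart_atP : forall p, chart_dom (chart_at p) p }.

Section Geometry.
Context {R : realType} {m : nat} (M : manifold R m).

(* T_p M is modelled on 'rV[R]_m: the row vector v stands for the tangent
   vector at p with components v in the chart [chart_at p]. *)
Local Notation T := 'rV[R]_m.

Implicit Types (p q : M) (u v w : T) (O : set M) (f : M -> R^o).
Implicit Types X Y Z : M -> T.

Definition map_at p : M -> T := chart_map (chart_at p).
Definition inv_at p : T -> M := chart_inv (chart_at p).

(* Components in the chart c of the tangent vector v at q. *)
Definition components (c : chart M) q v : T :=
  'd (chart_map c \o inv_at q) (map_at q q) v.

Definition field_in_chart (c : chart M) X : T -> T :=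
  fun x => components c (chart_inv c x) (X (chart_inv c x)).

(* The next two notions are used for O open only. *)
Definition smooth_fun O f : Prop :=
  forall c, smooth (chart_map c @` (chart_dom c `&` O)) (f \o chart_inv c).

Definition smooth_field O X : Prop :=
  forall c, smooth (chart_map c @` (chart_dom c `&` O)) (field_in_chart c X).

Definition smooth_fun_at p f : Prop :=
  exists2 O, open_nbhs p O & smooth_fun O f.

Definition smooth_field_at p X : Prop :=
  exists2 O, open_nbhs p O & smooth_field O X.

(* v(f), the derivative at p of f along the tangent vector v. *)
Definition dfun f p v : R := 'd (f \o inv_at p) (map_at p p) v.

Definition lie_bracket X Y p : T :=
  'd (field_in_chart (chart_at p) Y) (map_at p p) (X p)
  - 'd (field_in_chart (chart_at p) X) (map_at p p) (Y p).

(* The vector field with constant components v in the chart [chart_at p]; it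
   is smooth around p and extends the tangent vector v at p. Expressions in
   vector fields that are tensorial are evaluated at tangent vectors through
   this extension; by tensoriality any other smooth extension gives the same
   value. *)
Definition tangent_extension p v : M -> T :=
  fun q => 'd (map_at q \o inv_at p) (map_at p q) v.

Definition smooth_one_form (eta : M -> 'Hom(T, R^o)) : Prop :=
  forall O X, open O -> smooth_field O X ->
    smooth_fun O (fun q => eta q (X q)).

Definition smooth_endomorphism (phi : M -> 'End(T)) : Prop :=
  forall O X, open O -> smooth_field O X ->
    smooth_field O (fun q => phi q (X q)).

Definition exterior_derivative (eta : M -> 'Hom(T, R^o)) p u v : R :=
  let X := tangent_extension p u in let Y := tangent_extension p v in
  dfun (fun q => eta q (Y q)) p u - dfun (fun q => eta q (X q)) p v
  - eta p (lie_bracket X Y p).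

(* To be used with m = 2n + 1. *)
Definition contact_form (n : nat) (eta : M -> 'Hom(T, R^o)) : Prop :=
  smooth_one_form eta /\
  forall p, exists v : 'I_(1 + n * 2) -> T,
    wedge (form1 (eta p)) (wedge_power (form2 (exterior_derivative eta p)) n) v
    != 0.

Definition contact_distribution (eta : M -> 'Hom(T, R^o)) p : {vspace T} :=
  lker (eta p).

Record riemannian_metric := RiemannianMetric {
  metric :> M -> 'Hom(T, 'Hom(T, R^o));
  metric_sym : forall p u v, metric p u v = metric p v u;
  metric_pos : forall p u, u != 0 -> 0 < (metric p u u : R);
  metric_smooth : forall O X Y, open O -> smooth_field O X ->
    smooth_field O Y -> smooth_fun O (fun q => metric q (X q) (Y q)) }.

Record almost_contact_metric (phi : M -> 'End(T)) (xi : M -> T)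
    (eta : M -> 'Hom(T, R^o)) (g : riemannian_metric) : Prop := {
  acm_phi_smooth : smooth_endomorphism phi;
  acm_xi_smooth : smooth_field setT xi;
  acm_eta_smooth : smooth_one_form eta;
  acm_phi2 : forall p v,
    phi p (phi p v) = - v + (eta p v : R) *: xi p;
  acm_eta_xi : forall p, eta p (xi p) = 1;
  acm_metric : forall p u v,
    g p (phi p u) (phi p v) = g p u v - (eta p u : R) * (eta p v : R) }.

(* [cov X p v] is the covariant derivative of X at p along v. The axioms bear
   on fields that are smooth around a point rather than on M only: [cov] is
   the action of the connection on local vector fields, extended by arbitrary
   values where X is not smooth. *)
Record affine_connection := AffineConnection {
  cov :> (M -> T) -> M -> 'End(T);
  covD : forall p X Y, smooth_field_at p X -> smooth_field_at p Y ->
    cov (fun q => X q + Y q) p = cov X p + cov Y p;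
  cov_leibniz : forall p f X v, smooth_fun_at p f -> smooth_field_at p X ->
    cov (fun q => (f q : R) *: X q) p v
      = dfun f p v *: X p + (f p : R) *: cov X p v;
  cov_smooth : forall O X Y, open O -> smooth_field O X -> smooth_field O Y ->
    smooth_field O (fun q => cov Y q (X q)) }.

Record levi_civita (g : riemannian_metric) (nabla : affine_connection) : Prop :=
{ torsion_free : forall p X Y, smooth_field_at p X -> smooth_field_at p Y ->
    nabla Y p (X p) - nabla X p (Y p) = lie_bracket X Y p;
  metric_compatible : forall p v Y Z,
    smooth_field_at p Y -> smooth_field_at p Z ->
    dfun (fun q => g q (Y q) (Z q)) p v
      = g p (nabla Y p v) (Z p) + g p (Y p) (nabla Z p v) }.

(* (nabla_u phi) v *)
Definition cov_endomorphism (nabla : affine_connection) (phi : M -> 'End(T))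
    p u v : T :=
  let Y := tangent_extension p v in
  nabla (fun q => phi q (Y q)) p u - phi p (nabla Y p u).

(* R(u, v) w *)
Definition curvature (nabla : affine_connection) p u v w : T :=
  let X := tangent_extension p u in let Y := tangent_extension p v in
  let Z := tangent_extension p w in
  nabla (fun q => nabla Z q (Y q)) p u - nabla (fun q => nabla Z q (X q)) p v
  - nabla Z p (lie_bracket X Y p).

(* To be used with \dim pi = 2; the value does not depend on the basis. *)
Definition sectional_curvature (g : riemannian_metric)
    (nabla : affine_connection) p (pi : {vspace T}) : R :=
  let u := (vbasis pi)`_0 in let v := (vbasis pi)`_1 in
  (g p (curvature nabla p u v v) u : R)
  / ((g p u u : R) * (g p v v : R) - (g p u v : R) ^+ 2).

End Geometry.

(* Main.v *)
(* On D, write J for phi, A for nabla xi and w(W, X) = <AW, X> - <AX, W> for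
   d eta. Differentiating (nabla_X phi) Y = <Y, JAX> xi + eta(X) (nabla_xi phi) Y,
   valid for Y in D, and alternating, the Ricci identity for phi and the
   constancy of the curvature on D_p give, for the complex-bilinear product
   q(W, X) = W /\ X - JW /\ JX and the bilinear form b of nabla_xi phi on D_p,
     c q(JW, X) = - q(JAW, AX) + w(W, X) b.
   Since A is antilinear, replacing W by JW and applying J separates the two
   q-terms:
     2c q(JW, X)   = w(W, X) b + w(JW, X) b(J -, -),
     2  q(JAW, AX) = w(W, X) b - w(JW, X) b(J -, -).
   If c <> 0, the first line bounds the complex dimension of the space of
   bivectors q(W, X) by 1, so dim D <= 4, and the second one shows that a vector
   of ker A is w-orthogonal to D. If c = 0, the first line forces b = 0, and the
   second one that A has complex rank at most 1; so A has a kernel as soon as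
   dim D > 2, and w is degenerate as soon as dim D > 4. The contact condition
   says that w is nondegenerate on D; being antilinear for J, w vanishes if
   dim D = 2. *)
From HB Require Import structures.
Require Import Defs.
From mathcomp Require Import all_boot all_order all_algebra all_fingroup.
From mathcomp Require Import all_classical all_reals all_analysis.
From mathcomp Require Import ring lra.

Import Order.TTheory GRing.Theory Num.Theory.
Import numFieldNormedType.Exports.

Set Implicit Arguments.
Unset Strict Implicit.
Unset Printing Implicit Defensive.

Local Open Scope ring_scope.
Local Open Scope classical_set_scope.

(** * Differentials and maps of class C^k *)

Section Differential.
Context {R : realType} {V W : normedModType R}.

(** The formula for nabla phi has two sources. By hypothesis (nabla_X phi) Y is vertical for X, Y in
    D, and differentiating <phi Y, xi> = 0 computes its xi component; the anticommutation gives A xi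
    = 0, so A sees only the horizontal part of X. No formula is available for nabla_xi phi, hence
    the unknown b. Its coefficient eta(X) vanishes at p when X is horizontal there, but its
    derivative survives and becomes d eta after alternation. Pairing the Ricci identity with Z in D
    leaves the curvature terms R(W, X, phi Y, Z) and R(W, X, Y, phi Z), whose four arguments all lie
    in D_p: this is how constant curvature on D_p enters. The formula for nabla phi needs Y
    horizontal in a whole neighbourhood. Vectors of D_p are therefore extended by the horizontal
    projections of coordinate fields, and the curvature, defined through coordinate extensions, must
    first be shown to be computable from any smooth extension of its last argument. *)

Lemma is_diff_near0 (h : V -> W) x :
  {near x, forall y, h y = 0} -> is_diff x h 0.
Proof.
move=> h0.
have hx0 : h x = 0 by exact: (nbhs_singleton h0).
have E : h \o shift x = cst (h x) + (0 : V -> W) +o_ (0 : V) id.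
  apply/eqaddoP => _/posnumP[e]; near=> y.
  rewrite !fctE hx0 !addr0 subr0 /=.
  have -> : h (y + x) = 0.
    near: y; move: h0; rewrite (near_shift 0 x) /=; apply: filterS => y /=.
    by rewrite subr0.
  by rewrite normr0 mulr_ge0.
have c0 : continuous (\0 : V -> W) by exact: cst_continuous.
have D : 'd h x = \0 :> (V -> W) := @diff_unique _ _ _ h (\0 : {linear V -> W}) x c0 E.
apply: DiffDef; last by rewrite D.
by apply/diff_locallyP; rewrite D.
Unshelve. all: by end_near. Qed.

(** Writing g = f + (g - f) reduces locality of the differential to [is_diff_near0]. *)
Lemma near_eq_is_diff (f g df : V -> W) x :
  {near x, forall y, f y = g y} -> is_diff x f df -> is_diff x g df.
Proof.
move=> fg dfx; have -> : g = f + (g - f) by apply/funext => y; rewrite !fctE addrC subrK.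
rewrite -[df]addr0.
apply: (@is_diffD _ _ _ f (g - f) df 0 x dfx (is_diff_near0 _)).
by near=> y; rewrite !fctE; apply/eqP; rewrite subr_eq0 eq_sym; apply/eqP; near: y.
Unshelve. all: by end_near. Qed.

Lemma near_eq_differentiable (f g : V -> W) x :
  {near x, forall y, f y = g y} -> differentiable f x -> differentiable g x.
Proof.
by move=> fg /differentiableP dfx; case: (near_eq_is_diff fg dfx).
Qed.

Lemma near_eq_diff (f g : V -> W) x :
  {near x, forall y, f y = g y} -> differentiable f x ->
  'd g x = 'd f x :> (V -> W).
Proof.
by move=> fg /differentiableP dfx; case: (near_eq_is_diff fg dfx).
Qed.

Lemma scale_is_bilinear :
  bilinear_for
    (GRing.Scale.Law.clone _ _ *:%R _) (GRing.Scale.Law.clone _ _ *:%R _)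
    (fun (a : R) (w : W) => a *: w).
Proof.
split=> [w | w] a x y /=.
by rewrite scalerDl scalerA.
by rewrite scalerDr !scalerA [a * w]mulrC.
Qed.

Lemma is_diff_scale (k dk : V -> R) (f df : V -> W) x :
  is_diff x k dk -> is_diff x f df ->
  is_diff x (fun y => k y *: f y) (fun v => k x *: df v + dk v *: f x).
Proof.
move=> dkx dfx.
have c : continuous (fun p : R * W => p.1 *: p.2).
  by move=> p; apply: scale_continuous.
pose bM := bilinear_isBilinear.Build R R W W _ _ _ scale_is_bilinear.
pose b : {bilinear R -> W -> W} := HB.pack (fun (a : R) (w : W) => a *: w) bM.
have db : is_diff (k x, f x) (fun p : R * W => p.1 *: p.2)
   (fun q => k x *: q.2 + q.1 *: f x).
  apply: DiffDef; first exact: (@differentiable_bilin _ _ _ _ b (k x, f x) c).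
  exact: (@diff_bilin _ _ _ _ b (k x, f x) c).
have dp := is_diff_pair dkx dfx.
exact: (@is_diff_comp _ _ _ _ _ _ _ _ _ dp db).
Qed.

End Differential.

(** * Closure properties of maps of class C^k *)

Section Ck.
Context {R : realType} {V W : normedModType R}.
Implicit Types (f g : V -> W) (U : set V).

Lemma CkS_diff k U f x : Ck k.+1 U f -> U x -> differentiable f x.
Proof. by move=> -[df _] /df. Qed.

Lemma CkS k U f : (forall x, U x -> differentiable f x) ->
  (forall v, Ck k U (fun x => 'd f x v)) -> Ck k.+1 U f.
Proof. by []. Qed.

Lemma CkW k U f : Ck k.+1 U f -> Ck k U f.
Proof.
elim: k f => [|k IH] f [df Cf] /=.
  by move=> x Ux; apply: differentiable_continuous; exact: df.
by split=> // v; apply: IH; exact: Cf.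
Qed.

Lemma Ck_sub k U U' f : U' `<=` U -> Ck k U f -> Ck k U' f.
Proof.
move=> sU; elim: k f => [|k IH] f /=; first by move=> cf x /sU; exact: cf.
by move=> -[df Cf]; split=> [x /sU /df //|v]; exact: IH.
Qed.

(** Openness turns equality on U into equality near each point, so the differentials agree on U too
    and the induction passes to them. Below, this is how a derivative is replaced by its formula. *)
Lemma Ck_eq k U f g : open U -> (forall x, U x -> f x = g x) ->
  Ck k U f -> Ck k U g.
Proof.
move=> oU; elim: k f g => [|k IH] f g fg /=.
  move=> cf x Ux; rewrite /prop_for /continuous_at -(fg x Ux).
  apply: cvg_trans (cf _ Ux); apply: near_eq_cvg.
  by apply: filterS (open_nbhs_nbhs (conj oU Ux)).
have nfg x : U x -> {near x, forall y, f y = g y}.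
  by move=> Ux; apply: filterS (open_nbhs_nbhs (conj oU Ux)).
move=> -[df Cf]; split=> [x Ux|v].
  exact: near_eq_differentiable (nfg x Ux) (df x Ux).
apply: IH (Cf v) => x Ux.
exact: (esym (congr1 (@^~ v) (near_eq_diff (nfg x Ux) (df x Ux)))).
Qed.

Lemma Ck_cst k U (w : W) : open U -> Ck k U (cst w).
Proof.
move=> oU; elim: k w => [|k IH] w /=; first by move=> x _; exact: cst_continuous.
split=> [x _|v]; first exact: differentiable_cst.
by apply: (Ck_eq oU _ (IH 0)) => x _; rewrite diff_cst.
Qed.

Lemma CkD k U f g : open U -> Ck k U f -> Ck k U g ->
  Ck k U (fun x => f x + g x).
Proof.
move=> oU; elim: k f g => [|k IH] f g /=.
  by move=> cf cg x Ux; apply: continuousD; [exact: cf|exact: cg].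
move=> -[df Cf] [dg Cg]; split=> [x Ux|v].
  by apply: (differentiableD (df x Ux) (dg x Ux)).
apply: (Ck_eq oU _ (IH _ _ (Cf v) (Cg v))) => x Ux.
have E : 'd (fun x => f x + g x) x = 'd f x \+ 'd g x :> (V -> W) := diffD (df x Ux) (dg x Ux).
exact: (esym (congr1 (@^~ v) E)).
Qed.

Lemma Ck_sum k U (I : Type) (r : seq I) (F : I -> V -> W) :
  open U -> (forall i, Ck k U (F i)) -> Ck k U (fun x => \sum_(i <- r) F i x).
Proof.
move=> oU CF; elim: r => [|i r IH].
  by apply: (Ck_eq oU _ (Ck_cst k (0 : W) oU)) => x _; rewrite big_nil.
by apply: (Ck_eq oU _ (CkD oU (CF i) IH)) => x _; rewrite big_cons.
Qed.

End Ck.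

Section CkScale.
Context {R : realType} {V W : normedModType R}.
Implicit Types (f g : V -> W) (U : set V).

Lemma Ck_scale k U (h : V -> R^o) f : open U -> Ck k U h -> Ck k U f ->
  Ck k U (fun x => (h x : R) *: f x).
Proof.
move=> oU; elim: k h f => [|k IH] h f.
  move=> ch cf x Ux; apply: (@cvgZ _ _ _ _ _ h f (h x) (f x)).
    exact: ch.
  exact: cf.
move=> Ch Cf; have [[dh dCh] [df dCf]] := (Ch, Cf); apply: CkS => [x Ux|v].
  have := @is_diff_scale _ _ _ h ('d h x) f ('d f x) x (differentiableP (dh x Ux)) (differentiableP (df x Ux)).
  by case.
apply: (Ck_eq oU _ (CkD oU (IH _ _ (CkW Ch) (dCf v)) (IH _ _ (dCh v) (CkW Cf)))).
move=> x Ux.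
have [_ E] := @is_diff_scale _ _ _ h ('d h x) f ('d f x) x (differentiableP (dh x Ux)) (differentiableP (df x Ux)).
exact: (esym (congr1 (@^~ v) E)).
Qed.

Lemma Ck_linear k U (W' : normedModType R) (L : {linear W -> W'}) f :
  open U -> continuous L -> Ck k U f -> Ck k U (fun x => L (f x)).
Proof.
move=> oU cL; elim: k f => [|k IH] f.
  by move=> cf x Ux; apply: continuous_comp; [exact: cf|exact: cL].
move=> -[df Cf]; apply: CkS => [x Ux|v].
  apply: (differentiable_comp (df x Ux)); exact: linear_differentiable.
apply: (Ck_eq oU _ (IH _ (Cf v))) => x Ux /=.
have E := diff_comp (df x Ux) (linear_differentiable (f x) cL).
by rewrite [RHS](congr1 (@^~ v) E) /= diff_lin.
Qed.

End CkScale.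

Section CkRow.
Context {R : realType} {V W : normedModType R} {m : nat}.

Lemma continuous_row_coord (i : 'I_m) : continuous (fun v : 'rV[R]_m => v ord0 i : R^o).
Proof. exact: coord_continuous. Qed.

Lemma Ck_coord k (U : set V) (f : V -> 'rV[R]_m) i : open U -> Ck k U f ->
  Ck k U (fun x => f x ord0 i : R^o).
Proof.
move=> oU.
have lin : linear (fun v : 'rV[R]_m => v ord0 i : R^o) by move=> a u v; rewrite !mxE.
pose LM := GRing.isLinear.Build _ _ _ _ _ lin.
pose L : {linear 'rV[R]_m -> R^o} := HB.pack (fun v : 'rV[R]_m => v ord0 i : R^o) LM.
exact: (@Ck_linear _ _ _ k U _ L f oU (@continuous_row_coord i)).
Qed.

Lemma linear_row_sum (L : {linear 'rV[R]_m -> W}) (v : 'rV[R]_m) :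
  L v = \sum_i v ord0 i *: L (delta_mx 0 i).
Proof.
rewrite [v in LHS]row_sum_delta linear_sum; apply: eq_bigr => i _.
by rewrite linearZ.
Qed.

(** The chain rule produces 'd f (g x) applied to a vector that varies with x, whereas [Ck] controls
    differentials along fixed vectors only. Expanding the varying vector in the standard basis
    reduces one to the other. *)
Lemma Ck_comp k (U : set V) (U' : set 'rV[R]_m) (f : 'rV[R]_m -> W)
    (g : V -> 'rV[R]_m) : open U -> open U' ->
  (forall x, U x -> U' (g x)) ->
  Ck k U' f -> Ck k U g -> Ck k U (f \o g).
Proof.
move=> oU oU' gU; elim: k f g gU => [|k IH] f g gU.
  move=> cf cg x Ux; apply: continuous_comp; first exact: cg.
  by apply: cf; exact: gU.
move=> Cf Cg; have [[df dCf] [dg dCg]] := (Cf, Cg); apply: CkS => [x Ux|v].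
  by apply: differentiable_comp; [exact: dg|exact/df/gU].
apply: (Ck_eq oU _ (Ck_sum (index_enum 'I_m) oU (fun i =>
   Ck_scale oU (Ck_coord i oU (dCg v))
     (IH _ _ gU (dCf (delta_mx 0 i : 'rV[R]_m)) (CkW Cg))))).
move=> x Ux; rewrite [RHS](congr1 (@^~ v) (diff_comp (dg x Ux) (df _ (gU _ Ux)))) /=.
exact: (esym (linear_row_sum ('d f (g x)) ('d g x v))).
Qed.

Lemma Ck_diff_along k (U : set V) (U' : set 'rV[R]_m) (f : 'rV[R]_m -> W)
    (g h : V -> 'rV[R]_m) : open U -> open U' ->
  (forall x, U x -> U' (g x)) ->
  Ck k.+1 U' f -> Ck k U g -> Ck k U h -> Ck k U (fun x => 'd f (g x) (h x)).
Proof.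
move=> oU oU' gU -[df dCf] Cg Ch.
apply: (Ck_eq oU _ (Ck_sum (index_enum 'I_m) oU (fun i =>
   Ck_scale oU (Ck_coord i oU Ch)
     (Ck_comp oU oU' gU (dCf (delta_mx 0 i : 'rV[R]_m)) Cg)))).
by move=> x Ux; exact: (esym (linear_row_sum ('d f (g x)) (h x))).
Qed.

End CkRow.

(** * Symmetry of second derivatives *)

Section Schwarz.
Context {R : realType} {V : normedModType R}.
Implicit Types (f : V -> R^o) (U : set V) (x y u v : V).

Lemma is_derive_line f y u (s : R) : differentiable f (y + s *: u) ->
  is_derive s (1 : R) (fun s : R => f (y + s *: u) : R) ('d f (y + s *: u) u : R).
Proof.
move=> df.
have dl : is_diff s (fun s : R => y + s *: u) (fun t : R => t *: u).
  have := @is_diffD _ _ _ _ _ _ _ s (is_diff_cst y s) (is_diff_scalel s u).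
  by rewrite add0r.
have [dg Eg] := @is_diff_comp _ _ _ _ _ _ _ _ _ dl (differentiableP df).
apply: DeriveDef; first exact: (diff_derivable dg).
rewrite (deriveE _ dg).
by rewrite [LHS](congr1 (@^~ 1) Eg) /= scale1r.
Qed.

(** The alternating sum of f over the corners of a parallelogram. Its symmetry in u and v is the
    source of the symmetry of second derivatives. *)
Let second_difference f x u v (h : R) : R :=
  f (x + h *: v + h *: u) - f (x + h *: u) - (f (x + h *: v) - f x).

Lemma MVT_is_derive (f df : R -> R) (h : R) : 0 < h ->
  (forall t, 0 <= t <= h -> is_derive t 1 f (df t)) ->
  exists2 c, 0 < c < h & f h - f 0 = df c * h.
Proof.
move=> h0 fd.
have fd' t : t \in `]0, h[%R -> is_derive t 1 f (df t).
  by rewrite in_itv /= => /andP[t0 th]; apply: fd; rewrite !ltW.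
have cf : {within `[0, h], continuous f}.
  apply: derivable_within_continuous => t; rewrite in_itv /= => /fd.
  by case.
have [c cI E] := MVT h0 fd' cf.
by move: cI; rewrite in_itv /= => cI; rewrite subr0 in E; exists c.
Qed.

(** Two mean value theorems, along u for the increment of f over h v, then along v for the
    differential of f in direction u, turn the second difference into h^2 times a second derivative
    at a point of the parallelogram; continuity of that derivative concludes. *)
Lemma second_difference_cvg f U x u v (e : R) : open U -> Ck 2 U f -> U x ->
  0 < e -> exists2 d : R, 0 < d & forall h, 0 < h < d ->
    `|second_difference f x u v h / h ^+ 2
        - ('d (fun y => 'd f y u) x v : R)| < e.
Proof.
move=> oU [df Cf] Ux e0; have [ddf C0] := Cf u.
pose D y : R := 'd (fun y => 'd f y u) y v.
have : \forall y \near x, U y /\ `|D x - D y| < e.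
  apply: filterI; first exact: (open_nbhs_nbhs (conj oU Ux)).
  have /cvgrPdist_lt /(_ e e0) := C0 v x Ux; exact.
move=> /nbhs_ballP[r /= r0 xr].
have n0 : 0 < `|u| + `|v| + 1 by rewrite ltr_wpDl// addr_ge0.
(* With this bound the whole parallelogram lies in the ball of radius r; the summand 1 covers u = v
   = 0. *)
exists (r / (`|u| + `|v| + 1)); first exact: divr_gt0.
move=> h /andP[h0]; rewrite ltr_pdivlMr// => hr.
have xr' (s t : R) : 0 <= s <= h -> 0 <= t <= h ->
    U (x + s *: u + t *: v) /\ `|D x - D (x + s *: u + t *: v)| < e.
  move=> /andP[s0 sh] /andP[t0 th]; apply: xr.
  rewrite -ball_normE /= -addrA opprD addrA subrr add0r normrN.
  apply: le_lt_trans hr; apply: le_trans (ler_normD _ _) _.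
  rewrite !normrZ (ger0_norm s0) (ger0_norm t0) !mulrDr.
  apply: ler_wpDr; first by rewrite mulr1 ltW.
  by apply: lerD; rewrite ler_wpM2r.
have h01 : 0 <= (0 : R) <= h by rewrite lexx ltW.
have h02 : 0 <= h <= h by rewrite lexx ltW.
pose g1 (s : R) : R := f (x + h *: v + s *: u) - f (x + s *: u).
have g1d t : 0 <= t <= h -> is_derive t 1 g1
    (('d f (x + h *: v + t *: u) u : R) - ('d f (x + t *: u) u : R)).
  move=> tI; apply: is_deriveB; apply: is_derive_line; apply: df.
    by rewrite addrAC; exact: (xr' t h tI h02).1.
  by have [] := xr' t 0 tI h01; rewrite scale0r addr0.
have [s /andP[s0 sh] E1] := MVT_is_derive h0 g1d.
have sI : 0 <= s <= h by rewrite !ltW.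
pose g2 (t : R) : R := 'd f (x + s *: u + t *: v) u.
have g2d t : 0 <= t <= h -> is_derive t 1 g2 (D (x + s *: u + t *: v)).
  move=> tI; apply: (@is_derive_line (fun y => 'd f y u) (x + s *: u) v t).
  by apply: ddf; exact: (xr' s t sI tI).1.
have [t /andP[t0 th] E2] := MVT_is_derive h0 g2d.
have tI : 0 <= t <= h by rewrite !ltW.
have -> : second_difference f x u v h = D (x + s *: u + t *: v) * h ^+ 2.
  rewrite /second_difference; move: E1; rewrite /g1 !scale0r !addr0 => ->.
  move: E2; rewrite /g2 scale0r addr0 => E2.
  by rewrite [x + h *: v + _]addrAC E2 expr2 mulrA.
rewrite mulfK ?sqrf_eq0 ?gt_eqF// distrC.
exact: (xr' s t sI tI).2.
Qed.

Lemma diff2_sym f U x u v : open U -> Ck 2 U f -> U x ->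
  'd (fun y => 'd f y u) x v = 'd (fun y => 'd f y v) x u.
Proof.
move=> oU Cf Ux; apply/eqP; rewrite -subr_eq0 -normr_le0.
apply/ler_addgt0Pl => e e0; rewrite addr0.
have e2 : 0 < e / 2 by rewrite divr_gt0.
have [d1 d10 H1] := second_difference_cvg u v oU Cf Ux e2.
have [d2 d20 H2] := second_difference_cvg v u oU Cf Ux e2.
pose h := Num.min d1 d2 / 2.
have m0 : 0 < Num.min d1 d2 by rewrite lt_min d10.
have hm : h < Num.min d1 d2 by rewrite /h ltr_pdivrMr// ltr_pMr// ltr1n.
have h0 : 0 < h by rewrite divr_gt0.
move: hm; rewrite lt_min => /andP[hd1 hd2].
have {}H1 := H1 h; rewrite h0 hd1 in H1; have {}H1 := H1 isT.
have {}H2 := H2 h; rewrite h0 hd2 in H2; have {}H2 := H2 isT.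
have E : second_difference f x v u h = second_difference f x u v h.
  rewrite /second_difference [x + h *: u + _]addrAC.
  by rewrite !opprB addrACA [RHS]addrACA [- f (x + h *: v) - _]addrC.
rewrite E in H2; rewrite distrC in H1.
have := ltrD H1 H2; rewrite -splitr => /(le_lt_trans (ler_normD _ _))/ltW.
by rewrite addrA subrK.
Qed.

Lemma diff_row_coord m (f : V -> 'rV[R]_m) x v i : differentiable f x ->
  'd (fun y => f y ord0 i : R^o) x v = 'd f x v ord0 i.
Proof.
move=> df.
have lin : linear (fun v : 'rV[R]_m => v ord0 i : R^o) by move=> a u w; rewrite !mxE.
pose LM := GRing.isLinear.Build _ _ _ _ _ lin.
pose L : {linear 'rV[R]_m -> R^o} := HB.pack (fun v : 'rV[R]_m => v ord0 i : R^o) LM.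
have cL : continuous L := @continuous_row_coord R m i.
have E := diff_comp df (linear_differentiable (f x) cL).
apply: etrans (congr1 (@^~ v) E) _.
exact: (congr1 (@^~ ('d f x v)) (diff_lin (f x) cL)).
Qed.

Lemma diff2_sym_row m (f : V -> 'rV[R]_m) U x u v : open U -> Ck 2 U f -> U x ->
  'd (fun y => 'd f y u) x v = 'd (fun y => 'd f y v) x u.
Proof.
move=> oU Cf Ux; apply/rowP => i.
have E w w' : 'd (fun y => 'd f y w) x w' ord0 i
    = 'd (fun y => 'd (fun z => f z ord0 i : R^o) y w) x w'.
  have d2 : differentiable (fun y => 'd f y w) x := (Cf.2 w).1 x Ux.
  have dc : differentiable (fun y => 'd f y w ord0 i : R^o) x.
    exact: (CkS_diff (Ck_coord (k := 1) i oU (Cf.2 w))).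
  have N : {near x, forall y, 'd f y w ord0 i = 'd (fun z => f z ord0 i : R^o) y w}.
    apply: filterS (open_nbhs_nbhs (conj oU Ux)) => y Uy.
    by rewrite diff_row_coord//; exact: Cf.1.
  apply: etrans (esym (diff_row_coord w' i d2)) _.
  exact: (esym (congr1 (@^~ w') (near_eq_diff N dc))).
by rewrite !E; exact: (diff2_sym _ _ oU (Ck_coord (k := 2) i oU Cf)).
Qed.

End Schwarz.

(** * Charts and smooth fields *)

Section Charts.
Context {R : realType} {m : nat} {M : manifold R m}.
Implicit Types (c d e : chart M) (p q : M) (O : set M) (x v : 'rV[R]_m).

Definition chart_image c O : set 'rV[R]_m := chart_map c @` (chart_dom c `&` O).

Definition transition c d : 'rV[R]_m -> 'rV[R]_m := chart_map d \o chart_inv c.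

Lemma chart_imageP c O x : chart_image c O x ->
  [/\ chart_dom c (chart_inv c x), O (chart_inv c x)
    & chart_map c (chart_inv c x) = x].
Proof. by move=> [q [cq Oq] <-]; rewrite !chart_mapK. Qed.

Lemma chart_image_map c O q : chart_dom c q -> O q -> chart_image c O (chart_map c q).
Proof. by move=> cq Oq; exists q. Qed.

Lemma open_chart_image c O : open O -> open (chart_image c O).
Proof.
move=> oO; have oi := @chart_map_open _ _ M c.
have := @chart_inv_continuous _ _ M c.
rewrite continuous_open_subspace// => /(continuous_inP _ oi) /(_ O oO).
congr open; apply/seteqP; split=> x.
  by move=> [[q cq <-]] /=; rewrite chart_mapK// => Oq; exists q.
by move=> [q [cq Oq] <-]; split; [exists q|rewrite /= chart_mapK].
Qed.


Lemma transition_map c d q : chart_dom c q ->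
  transition c d (chart_map c q) = chart_map d q.
Proof. by move=> cq; rewrite /transition /= chart_mapK. Qed.

Lemma Ck_transition k c d : Ck k (chart_image c (chart_dom d)) (transition c d).
Proof. exact: transition_smooth. Qed.

Lemma transition_image c d O x : O `<=` chart_dom d -> chart_image c O x ->
  chart_image d (chart_dom c `&` O) (transition c d x).
Proof.
move=> Od /chart_imageP[cx Ox xE]; exists (chart_inv c x) => //.
by split=> //; exact: Od.
Qed.

Lemma differentiable_transition c d q : chart_dom c q -> chart_dom d q ->
  differentiable (transition c d) (chart_map c q).
Proof.
move=> cq dq; apply: (CkS_diff (Ck_transition 1 c d)).
exact: chart_image_map.
Qed.

Lemma chart_nbhs c O q : open O -> chart_dom c q -> O q ->
  nbhs (chart_map c q) (chart_image c O).
Proof.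
move=> oO cq Oq; apply: open_nbhs_nbhs; split; first exact: open_chart_image.
exact: chart_image_map.
Qed.

Lemma diff_transition_comp c d e q v :
  chart_dom c q -> chart_dom d q -> chart_dom e q ->
  'd (transition d e) (chart_map d q) ('d (transition c d) (chart_map c q) v)
  = 'd (transition c e) (chart_map c q) v.
Proof.
move=> cq dq eq.
have dcd := differentiable_transition cq dq.
have tq := transition_map d cq.
have dde : differentiable (transition d e) (transition c d (chart_map c q)).
  by rewrite tq; exact: differentiable_transition.
have E1 := congr1 (@^~ v) (diff_comp dcd dde).
rewrite -[in LHS]tq; apply: etrans (esym E1) _.
have N : {near chart_map c q, forall x,
    (transition d e \o transition c d) x = transition c e x}.
  have := @chart_nbhs c _ q (chart_dom_open d) cq dq.
  apply: filterS => x /chart_imageP[cx dx _].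
  by rewrite /transition /= chart_mapK.
exact: (esym (congr1 (@^~ v) (near_eq_diff N (differentiable_comp dcd dde)))).
Qed.

Lemma diff_transition_id c q v : chart_dom c q ->
  'd (transition c c) (chart_map c q) v = v.
Proof.
move=> cq.
have N : {near chart_map c q, forall x, id x = transition c c x}.
  have := @chart_nbhs c _ q (chart_dom_open c) cq cq.
  by apply: filterS => x /chart_imageP[_ _ E]; rewrite /transition /= E.
have di := is_diff_id (chart_map c q).
have E := near_eq_diff N (@ex_diff _ _ _ _ _ _ _ di).
by rewrite (congr1 (@^~ v) E) /= diff_val.
Qed.

Lemma componentsE c q v :
  components c q v = 'd (transition (chart_at q) c) (chart_map (chart_at q) q) v.
Proof. by []. Qed.

Lemma components_tangent_extension c p q v :
  chart_dom c q -> chart_dom (chart_at p) q ->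
  components c q (tangent_extension p v q)
  = 'd (transition (chart_at p) c) (chart_map (chart_at p) q) v.
Proof.
move=> cq pq; apply: diff_transition_comp => //; exact: chart_atP.
Qed.

Lemma components_tangent_extension_at p q v : chart_dom (chart_at p) q ->
  components (chart_at p) q (tangent_extension p v q) = v.
Proof.
by move=> pq; rewrite components_tangent_extension// diff_transition_id.
Qed.

Lemma tangent_extension_components p q v : chart_dom (chart_at p) q ->
  tangent_extension p (components (chart_at p) q v) q = v.
Proof.
move=> pq; rewrite -[RHS](@diff_transition_id (chart_at q) q v (chart_atP q)).
by apply: diff_transition_comp => //; exact: chart_atP.
Qed.

Lemma tangent_extension_id p v : tangent_extension p v p = v.
Proof. exact: diff_transition_id (chart_atP p). Qed.

Lemma tangent_extensionD p u v q :
  tangent_extension p (u + v) q = tangent_extension p u q + tangent_extension p v q.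
Proof. by rewrite /tangent_extension linearD. Qed.

Lemma tangent_extensionZ p (a : R) v q :
  tangent_extension p (a *: v) q = a *: tangent_extension p v q.
Proof. by rewrite /tangent_extension linearZ. Qed.

Lemma tangent_frame p q v : chart_dom (chart_at p) q ->
  v = \sum_i (components (chart_at p) q v) ord0 i
        *: tangent_extension p (delta_mx 0 i) q.
Proof.
move=> pq; rewrite -{1}(tangent_extension_components v pq).
exact: linear_row_sum.
Qed.

End Charts.

Arguments open_chart_image {R m M} c {O}.
Arguments chart_nbhs {R m M} c {O q}.

(** * Smooth functions, smooth fields and coordinate fields *)

Section SmoothFunctions.
Context {R : realType} {m : nat} {M : manifold R m}.
Implicit Types (c d e : chart M) (p q : M) (O : set M) (u v : 'rV[R]_m).
Implicit Types (f h : M -> R^o) (X Y : M -> 'rV[R]_m).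

Lemma smooth_field_sub O O' X : O' `<=` O -> smooth_field O X -> smooth_field O' X.
Proof.
move=> sO sX c k; apply: Ck_sub (sX c k) => _ [q [cq /sO Oq] <-].
exact: chart_image_map.
Qed.

Lemma eq_smooth_fun O f h : open O -> (forall q, O q -> f q = h q) ->
  smooth_fun O f -> smooth_fun O h.
Proof.
move=> oO fh sf c k; apply: Ck_eq (sf c k); first exact: open_chart_image.
by move=> x /chart_imageP[_ Ox _] /=; exact: fh.
Qed.

Lemma eq_smooth_field O X Y : open O -> (forall q, O q -> X q = Y q) ->
  smooth_field O X -> smooth_field O Y.
Proof.
move=> oO XY sX c k; apply: Ck_eq (sX c k); first exact: open_chart_image.
by move=> x /chart_imageP[_ Ox _] /=; rewrite /field_in_chart XY.
Qed.

Lemma smooth_fun_cst O (a : R) : open O -> smooth_fun O (fun=> a : R^o).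
Proof.
move=> oO c k; have oc := open_chart_image c oO.
exact: (Ck_eq oc _ (Ck_cst k (a : R^o) oc)).
Qed.

Lemma smooth_funD O f h : open O -> smooth_fun O f -> smooth_fun O h ->
  smooth_fun O (fun q => f q + h q).
Proof.
move=> oO sf sh c k; have oc := open_chart_image c oO.
exact: (Ck_eq oc _ (CkD oc (sf c k) (sh c k))).
Qed.

Lemma smooth_fieldD O X Y : open O -> smooth_field O X -> smooth_field O Y ->
  smooth_field O (fun q => X q + Y q).
Proof.
move=> oO sX sY c k; have oc := open_chart_image c oO.
apply: (Ck_eq oc _ (CkD oc (sX c k) (sY c k))) => x _.
by rewrite /field_in_chart /components linearD.
Qed.

Lemma smooth_fieldZ O f X : open O -> smooth_fun O f -> smooth_field O X ->
  smooth_field O (fun q => (f q : R) *: X q).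
Proof.
move=> oO sf sX c k; have oc := open_chart_image c oO.
apply: (Ck_eq oc _ (Ck_scale oc (sf c k) (sX c k))) => x _.
by rewrite /field_in_chart /components linearZ.
Qed.

Lemma smooth_field0 O : open O -> smooth_field O (fun=> 0 : 'rV[R]_m).
Proof.
move=> oO c k; have oc := open_chart_image c oO.
apply: (Ck_eq oc _ (Ck_cst k (0 : 'rV[R]_m) oc)) => x _.
by rewrite /field_in_chart /components linear0.
Qed.

Lemma smooth_fieldN O X : open O -> smooth_field O X ->
  smooth_field O (fun q => - X q).
Proof.
move=> oO sX; apply: (eq_smooth_field oO _ (smooth_fieldZ oO (smooth_fun_cst (-1) oO) sX)).
by move=> q _; rewrite scaleN1r.
Qed.

Lemma smooth_field_sum O (I : Type) (r : seq I) (F : I -> M -> 'rV[R]_m) :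
  open O -> (forall i, smooth_field O (F i)) ->
  smooth_field O (fun q => \sum_(i <- r) F i q).
Proof.
move=> oO sF; elim: r => [|i r IH].
  by apply: (eq_smooth_field oO _ (smooth_field0 oO)) => q _; rewrite big_nil.
apply: (eq_smooth_field oO _ (smooth_fieldD oO (sF i) IH)) => q _.
by rewrite big_cons.
Qed.

Lemma smooth_fun_in_chart O p f : open O -> O `<=` chart_dom (chart_at p) ->
  smooth (chart_image (chart_at p) O) (f \o inv_at p) -> smooth_fun O f.
Proof.
move=> oO Op sf c k.
have oc := open_chart_image c oO.
have oc' := open_chart_image (chart_at p) (openI (chart_dom_open c) oO).
have sub : chart_image (chart_at p) (chart_dom c `&` O) `<=` chart_image (chart_at p) O.
  by move=> _ [q [pq [_ Oq]] <-]; exact: chart_image_map.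
apply: (Ck_eq oc _ (@Ck_comp _ _ _ _ k _ _ (f \o inv_at p)
  (transition c (chart_at p)) oc oc' _ (Ck_sub sub (sf k)) _)).
- move=> x /chart_imageP[cx Ox _] /=.
  by rewrite /transition /inv_at /= chart_mapK//; exact: Op.
- by move=> x; exact: transition_image.
- apply: Ck_sub (Ck_transition k c (chart_at p)) => _ [q [cq /Op pq] <-].
  exact: chart_image_map.
Qed.

(** In a chart c the field is the differential of a transition map along the constant vector v, read
    at a point moved by the inverse transition. The differentiation costs one order, hence the
    [k.+1] in the proof. *)
Lemma smooth_tangent_extension p v :
  smooth_field (chart_dom (chart_at p)) (tangent_extension p v).
Proof.
move=> c k; set pc := chart_at p.
have oO := chart_dom_open pc; have oc := open_chart_image c oO.
have oc' := open_chart_image pc (openI (chart_dom_open c) oO).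
apply: (Ck_eq oc _ (@Ck_diff_along _ _ _ _ k _ _ (transition pc c)
  (transition c pc) (cst v) oc oc' _ _ _ (Ck_cst k v oc))).
- move=> x /chart_imageP[cx px xE].
  rewrite /field_in_chart components_tangent_extension//.
- by move=> x; exact: transition_image.
- apply: Ck_sub (Ck_transition k.+1 pc c) => _ [q [pq [cq _]] <-].
  exact: chart_image_map.
- exact: Ck_transition.
Qed.

Lemma smooth_fun_components O p X i : open O -> O `<=` chart_dom (chart_at p) ->
  smooth_field O X ->
  smooth_fun O (fun q => components (chart_at p) q (X q) ord0 i : R^o).
Proof.
move=> oO Op sX; apply: (smooth_fun_in_chart oO Op) => k.
exact: (Ck_coord i (open_chart_image (chart_at p) oO) (sX (chart_at p) k)).
Qed.

Lemma differentiable_fun O c q f : open O -> O q -> chart_dom c q ->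
  smooth_fun O f -> differentiable (f \o chart_inv c) (chart_map c q).
Proof.
move=> oO Oq cq sf; apply: (CkS_diff (sf c 1)); exact: chart_image_map.
Qed.

Lemma dfun_chart O c q f v : open O -> O q -> chart_dom c q -> smooth_fun O f ->
  dfun f q v = 'd (f \o chart_inv c) (chart_map c q) (components c q v).
Proof.
move=> oO Oq cq sf; set qc := chart_at q.
have dt := differentiable_transition (chart_atP q) cq.
have df : differentiable (f \o chart_inv c) (transition qc c (chart_map qc q)).
  rewrite transition_map; last exact: chart_atP.
  exact: (differentiable_fun oO).
have := congr1 (@^~ v) (diff_comp dt df).
rewrite /= transition_map; last exact: chart_atP.
rewrite -componentsE => <-.
have N : {near chart_map qc q, forall x,
    ((f \o chart_inv c) \o transition qc c) x = (f \o inv_at q) x}.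
  have := chart_nbhs qc (chart_dom_open c) (chart_atP q) cq.
  apply: filterS => x /chart_imageP[qx cx _].
  by rewrite /transition /= chart_mapK.
exact: (congr1 (@^~ v) (near_eq_diff N (differentiable_comp dt df))).
Qed.

Lemma dfun_local O f h q : open O -> O q -> (forall r, O r -> f r = h r) ->
  smooth_fun O f -> dfun h q =1 dfun f q.
Proof.
move=> oO Oq fh sf v.
have N : {near map_at q q, forall x, (f \o inv_at q) x = (h \o inv_at q) x}.
  have := chart_nbhs _ oO (chart_atP q) Oq.
  by apply: filterS => x /chart_imageP[qx Ox _] /=; exact: fh.
have df := differentiable_fun oO Oq (chart_atP q) sf.
exact: (congr1 (@^~ v) (near_eq_diff N df)).
Qed.

Lemma dfun_cst (a : R) q v : dfun (fun=> a : R^o) q v = 0.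
Proof. by rewrite /dfun (diff_cst (a : R^o) (map_at q q)). Qed.

Lemma dfunD O f h q v : open O -> O q -> smooth_fun O f -> smooth_fun O h ->
  dfun (fun r => f r + h r) q v = dfun f q v + dfun h q v.
Proof.
move=> oO Oq sf sh.
have df := differentiable_fun oO Oq (chart_atP q) sf.
have dh := differentiable_fun oO Oq (chart_atP q) sh.
exact: (congr1 (@^~ v) (diffD df dh)).
Qed.

Lemma dfun_tangent_extension O p q f v : open O -> O `<=` chart_dom (chart_at p) ->
  O q -> smooth_fun O f ->
  dfun f q (tangent_extension p v q) = 'd (f \o inv_at p) (map_at p q) v.
Proof.
move=> oO Op Oq sf; rewrite (dfun_chart _ oO Oq (Op _ Oq) sf).
by rewrite components_tangent_extension_at//; exact: Op.
Qed.

Lemma smooth_dfun_tangent_extension O p f v : open O ->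
  O `<=` chart_dom (chart_at p) -> smooth_fun O f ->
  smooth_fun O (fun q => dfun f q (tangent_extension p v q)).
Proof.
move=> oO Op sf; apply: (smooth_fun_in_chart oO Op) => k.
have oc := open_chart_image (chart_at p) oO.
apply: (Ck_eq oc _ ((sf (chart_at p) k.+1).2 v)).
move=> x /chart_imageP[px Ox xE] /=.
by rewrite (dfun_tangent_extension v oO Op Ox sf) /map_at /inv_at xE.
Qed.

(** The extensions have constant components in [chart_at p], so both sides are second partial
    derivatives of f in that chart. *)
Lemma dfun2_sym O p f u v : open O -> O `<=` chart_dom (chart_at p) -> O p ->
  smooth_fun O f ->
  dfun (fun q => dfun f q (tangent_extension p u q)) p v
  = dfun (fun q => dfun f q (tangent_extension p v q)) p u.
Proof.
move=> oO Op Opp sf; have oc := open_chart_image (chart_at p) oO.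
have E w : dfun (fun q => dfun f q (tangent_extension p w q)) p
    =1 'd (fun x => 'd (f \o inv_at p) x w) (map_at p p).
  move=> w'; rewrite /dfun; apply: (congr1 (@^~ w')); apply: near_eq_diff.
    have := chart_nbhs _ oO (chart_atP p) Opp.
    apply: filterS => x /chart_imageP[px Ox xE] /=.
    by rewrite [RHS](dfun_tangent_extension w oO Op Ox sf) /map_at /inv_at xE.
  apply: ((sf (chart_at p) 2%N).2 w).1.
  by apply: chart_image_map => //; exact: chart_atP.
rewrite !E; apply: (diff2_sym _ _ oc (sf (chart_at p) 2%N)).
by apply: chart_image_map => //; exact: chart_atP.
Qed.

Lemma lie_bracket_tangent_extension p u v :
  lie_bracket (tangent_extension p u) (tangent_extension p v) p = 0.
Proof.
have E w w' : 'd (field_in_chart (chart_at p) (tangent_extension p w)) (map_at p p) w' = 0.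
  have N : {near map_at p p, forall x,
      cst w x = field_in_chart (chart_at p) (tangent_extension p w) x}.
    have := chart_nbhs _ (chart_dom_open (chart_at p)) (chart_atP p) (chart_atP p).
    apply: filterS => x /chart_imageP[px Ox xE] /=.
    by rewrite /field_in_chart components_tangent_extension_at.
  have dc : differentiable (cst w) (map_at p p) by exact: differentiable_cst.
  rewrite (congr1 (@^~ w') (near_eq_diff N dc)).
  by rewrite (congr1 (@^~ w') (diff_cst w (map_at p p))).
by apply: etrans (congr2 (fun a b => a - b) (E v _) (E u _)) _; rewrite subrr.
Qed.

End SmoothFunctions.

(** * Connections and curvature *)

Section InnerProduct.
Context {R : realType} {m : nat} {M : manifold R m}.
Implicit Types (g : riemannian_metric M) (p : M) (u v w : 'rV[R]_m).

Definition inner g p u v : R := g p u v.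

Lemma innerC g p u v : inner g p u v = inner g p v u.
Proof. exact: Defs.metric_sym. Qed.

Lemma innerDl g p u v w : inner g p (u + v) w = inner g p u w + inner g p v w.
Proof. by rewrite /inner linearD add_lfunE. Qed.

Lemma innerZl g p (a : R) u w : inner g p (a *: u) w = a * inner g p u w.
Proof. by rewrite /inner linearZ scale_lfunE. Qed.

Lemma innerDr g p u v w : inner g p w (u + v) = inner g p w u + inner g p w v.
Proof. by rewrite innerC innerDl !(innerC g p w). Qed.

Lemma innerZr g p (a : R) u w : inner g p w (a *: u) = a * inner g p w u.
Proof. by rewrite innerC innerZl (innerC g p w). Qed.

Lemma innerNl g p u w : inner g p (- u) w = - inner g p u w.
Proof. by rewrite -scaleN1r innerZl mulN1r. Qed.

Lemma innerNr g p u w : inner g p w (- u) = - inner g p w u.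
Proof. by rewrite innerC innerNl (innerC g p w). Qed.

Lemma innerBl g p u v w : inner g p (u - v) w = inner g p u w - inner g p v w.
Proof. by rewrite innerDl innerNl. Qed.

Lemma innerBr g p u v w : inner g p w (u - v) = inner g p w u - inner g p w v.
Proof. by rewrite innerDr innerNr. Qed.

Lemma inner0l g p w : inner g p 0 w = 0.
Proof. by rewrite -[0 in LHS](scale0r (0 : 'rV[R]_m)) innerZl mul0r. Qed.

Lemma inner0r g p w : inner g p w 0 = 0.
Proof. by rewrite innerC inner0l. Qed.

Lemma inner_gt0 g p u : u != 0 -> 0 < inner g p u u.
Proof. exact: metric_pos. Qed.

Lemma inner_eq0 g p u : inner g p u u = 0 -> u = 0.
Proof. by move=> u0; apply: contra_eq u0 => /inner_gt0 => /(_ g p) /gt_eqF ->. Qed.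

End InnerProduct.

Section Connection.
Context {R : realType} {m : nat} {M : manifold R m}.
Variable nabla : affine_connection M.
Implicit Types (p q : M) (O : set M) (u v w y z : 'rV[R]_m).
Implicit Types (f h : M -> R^o) (X Y Z : M -> 'rV[R]_m).

Lemma smooth_field_at_open O p X : open O -> O p -> smooth_field O X ->
  smooth_field_at p X.
Proof. by move=> oO Op sX; exists O. Qed.

Lemma smooth_fun_at_open O p f : open O -> O p -> smooth_fun O f ->
  smooth_fun_at p f.
Proof. by move=> oO Op sf; exists O. Qed.

(* Since [cov_leibniz] only asks for smoothness around the point, the
   indicator function of an open set can replace a bump function. *)
Lemma cov_local O p X Y : open O -> O p -> smooth_field O X ->
  (forall q, O q -> X q = Y q) -> nabla Y p = nabla X p.
Proof.
move=> oO Op sX XY.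
pose f q : R^o := if `[< O q >] then 1 else 0.
have f1 q : O q -> 1 = f q by move=> Oq; rewrite /f asboolT.
have sf : smooth_fun O f := eq_smooth_fun oO f1 (smooth_fun_cst 1 oO).
have df v : dfun f p v = 0.
  by rewrite (dfun_local oO Op f1 (smooth_fun_cst 1 oO)) dfun_cst.
have fXY : (fun q => (f q : R) *: Y q) = (fun q => (f q : R) *: X q).
  apply/funext => q; rewrite /f; case: asboolP => [/XY ->//|_].
  by rewrite !scale0r.
apply/lfunP => v.
have sY := eq_smooth_field oO XY sX.
have EX := cov_leibniz nabla v (smooth_fun_at_open oO Op sf) (smooth_field_at_open oO Op sX).
have EY := cov_leibniz nabla v (smooth_fun_at_open oO Op sf) (smooth_field_at_open oO Op sY).
move: EY; rewrite fXY EX df -(f1 p Op).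
by rewrite !scale0r !scale1r !add0r.
Qed.

Lemma smooth_cov O X Y : open O -> smooth_field O X -> smooth_field O Y ->
  smooth_field O (fun q => nabla Y q (X q)).
Proof. exact: cov_smooth. Qed.

Section OnOpenSet.
Variables (O : set M) (p : M).
Hypotheses (oO : open O) (Op : O p).

Lemma cov_add X Y v : smooth_field O X -> smooth_field O Y ->
  nabla (fun q => X q + Y q) p v = nabla X p v + nabla Y p v.
Proof.
move=> sX sY; rewrite covD ?add_lfunE//; exact: (smooth_field_at_open oO Op).
Qed.

Lemma cov_scale f X v : smooth_fun O f -> smooth_field O X ->
  nabla (fun q => (f q : R) *: X q) p v
  = dfun f p v *: X p + (f p : R) *: nabla X p v.
Proof.
move=> sf sX; apply: cov_leibniz; first exact: (smooth_fun_at_open oO Op).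
exact: (smooth_field_at_open oO Op).
Qed.

Lemma cov_opp X v : smooth_field O X -> nabla (fun q => - X q) p v = - nabla X p v.
Proof.
move=> sX.
have -> : (fun q => - X q) = (fun q => -1 *: X q).
  by apply/funext => q; rewrite scaleN1r.
rewrite (cov_scale _ (smooth_fun_cst (-1) oO) sX) dfun_cst.
by rewrite scale0r add0r scaleN1r.
Qed.

Lemma cov_sub X Y v : smooth_field O X -> smooth_field O Y ->
  nabla (fun q => X q - Y q) p v = nabla X p v - nabla Y p v.
Proof.
by move=> sX sY; rewrite (cov_add _ sX (smooth_fieldN oO sY)) cov_opp.
Qed.

End OnOpenSet.

(** On O a field is the combination of the coordinate frame with its components as coefficients, so
    P X depends only on the components at p. The locality hypothesis is what allows X to be replaced
    by this combination, which equals X on O only. *)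
Lemma tensoriality O p (P : (M -> 'rV[R]_m) -> 'rV[R]_m) :
  open O -> O `<=` chart_dom (chart_at p) -> O p ->
  (forall X Y, smooth_field O X -> (forall q, O q -> X q = Y q) -> P Y = P X) ->
  (forall X Y, smooth_field O X -> smooth_field O Y ->
    P (fun q => X q + Y q) = P X + P Y) ->
  (forall f X, smooth_fun O f -> smooth_field O X ->
    P (fun q => (f q : R) *: X q) = (f p : R) *: P X) ->
  forall X Y, smooth_field O X -> smooth_field O Y -> X p = Y p -> P X = P Y.
Proof.
move=> oO sO Op Ploc PD PZ.
have P0 : P (fun=> 0) = 0.
  have -> : (fun=> 0 : 'rV[R]_m) = (fun q : M => (0 : R) *: (0 : 'rV[R]_m)).
    by apply/funext => q; rewrite scale0r.
  by rewrite (PZ _ _ (smooth_fun_cst 0 oO) (smooth_field0 oO)) scale0r.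
pose E i := tangent_extension p (delta_mx 0 i : 'rV[R]_m).
have sE i : smooth_field O (E i) by exact: smooth_field_sub (smooth_tangent_extension _ _).
pose co X i (q : M) : R^o := components (chart_at p) q (X q) ord0 i.
have sco X i : smooth_field O X -> smooth_fun O (co X i).
  exact: smooth_fun_components.
have Psum X (r : seq 'I_m) : smooth_field O X ->
   P (fun q => \sum_(i <- r) (co X i q : R) *: E i q)
   = \sum_(i <- r) (co X i p : R) *: P (E i).
  move=> sX; elim: r => [|i r IH].
    by rewrite big_nil -P0; congr P; apply/funext => q; rewrite big_nil.
  rewrite big_cons -IH -PZ//; last exact: sco.
  rewrite -PD.
  - by congr P; apply/funext => q; rewrite big_cons.
  - by apply: smooth_fieldZ => //; exact: sco.
  - by apply: smooth_field_sum => // j; apply: smooth_fieldZ => //; exact: sco.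
have PE X : smooth_field O X -> P X = \sum_(i <- index_enum 'I_m) (co X i p : R) *: P (E i).
  move=> sX; rewrite -Psum//; apply: (Ploc); last first.
    by move=> q Oq; rewrite [RHS](tangent_frame (X q) (sO _ Oq)).
  by apply: smooth_field_sum => // j; apply: smooth_fieldZ => //; exact: sco.
move=> X Y sX sY XY; rewrite (PE X sX) (PE Y sY).
by apply: eq_bigr => i _; rewrite /co XY.
Qed.

(** Frees [cov_endomorphism] from the coordinate extension in its definition: in the Leibniz rule
    the derivatives of the factor f cancel between the two terms, so the expression is tensorial in
    Y. *)
Lemma cov_endomorphism_field O (phi : M -> 'End('rV[R]_m)) p u Y :
  smooth_endomorphism phi -> open O -> O p -> smooth_field O Y ->
  nabla (fun q => phi q (Y q)) p u - phi p (nabla Y p u)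
  = cov_endomorphism nabla phi p u (Y p).
Proof.
move=> sphi oO Op sY; rewrite /cov_endomorphism.
set U := O `&` chart_dom (chart_at p).
have oU : open U by apply: openI => //; exact: chart_dom_open.
have Up : U p by split=> //; exact: chart_atP.
have sUY : smooth_field U Y by apply: smooth_field_sub sY => q [].
have sE : smooth_field U (tangent_extension p (Y p)).
  by apply: smooth_field_sub (smooth_tangent_extension _ _) => q [].
apply: (@tensoriality U p (fun Y => nabla (fun q => phi q (Y q)) p u - phi p (nabla Y p u)) oU _ Up _ _ _ _ _ sUY sE).
- by move=> q [].
- move=> X Z sX XZ; rewrite (cov_local oU Up sX XZ).
  have H q : U q -> phi q (X q) = phi q (Z q) by move=> Uq; rewrite XZ.
  by rewrite (cov_local oU Up (sphi _ _ oU sX) H).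
- move=> {sUY sE sY} {}Y Z sY' sZ'; rewrite (cov_add oU Up u sY' sZ').
  have -> : (fun q => phi q (Y q + Z q)) = (fun q => phi q (Y q) + phi q (Z q)).
    by apply/funext => q; rewrite linearD.
  rewrite (cov_add oU Up u (sphi _ _ oU sY') (sphi _ _ oU sZ')).
  by rewrite linearD opprD addrACA.
- move=> f {sUY sE sY} {}Y sf sY'; rewrite (cov_scale oU Up u sf sY').
  have -> : (fun q => phi q ((f q : R) *: Y q)) = (fun q => (f q : R) *: phi q (Y q)).
    by apply/funext => q; rewrite linearZ.
  rewrite (cov_scale oU Up u sf (sphi _ _ oU sY')).
  by rewrite linearD !linearZ /= opprD addrACA subrr add0r scalerBr.
- by rewrite tangent_extension_id.
Qed.

(* [nabla_u nabla_w Z - nabla_w nabla_u Z], with [u] and [w] extended by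
   commuting fields. *)
Definition second_cov_commutator p u w Z : 'rV[R]_m :=
  nabla (fun q => nabla Z q (tangent_extension p w q)) p u
  - nabla (fun q => nabla Z q (tangent_extension p u q)) p w.

Lemma curvatureE p u w z :
  curvature nabla p u w z = second_cov_commutator p u w (tangent_extension p z).
Proof.
by rewrite /curvature lie_bracket_tangent_extension linear0 subr0.
Qed.

(** * Tensoriality and symmetries of the curvature *)

Section CurvatureField.
Variable p : M.
Let O := chart_dom (chart_at p).
Let oO : open O := chart_dom_open _.
Let Op : O p := chart_atP p.
Let sE v : smooth_field O (tangent_extension p v) := smooth_tangent_extension p v.

Lemma second_cov_commutatorD u w Y Z : smooth_field O Y -> smooth_field O Z ->
  second_cov_commutator p u w (fun q => Y q + Z q)
  = second_cov_commutator p u w Y + second_cov_commutator p u w Z.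
Proof.
move=> sY sZ.
have H v v' : nabla (fun q => nabla (fun q => Y q + Z q) q (tangent_extension p v q)) p v'
   = nabla (fun q => nabla Y q (tangent_extension p v q)) p v'
     + nabla (fun q => nabla Z q (tangent_extension p v q)) p v'.
  rewrite -(cov_add oO Op); [|exact: smooth_cov..].
  congr (fun_of_lfun _ v'); apply: (@cov_local O) => //.
    by apply: smooth_fieldD => //; exact: smooth_cov.
  by move=> q Oq; rewrite (cov_add oO Oq _ sY sZ).
by rewrite /second_cov_commutator !H opprD addrACA.
Qed.

(** After two Leibniz rules the terms with first derivatives of f are symmetric in the two
    directions, and those with second derivatives agree by [dfun2_sym]; both disappear from the
    commutator. *)
Lemma second_cov_commutatorZ u w f Z : smooth_fun O f -> smooth_field O Z ->
  second_cov_commutator p u w (fun q => (f q : R) *: Z q)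
  = (f p : R) *: second_cov_commutator p u w Z.
Proof.
move=> sf sZ.
have H v v' : nabla (fun q => nabla (fun q => (f q : R) *: Z q) q (tangent_extension p v q)) p v'
   = dfun (fun q => dfun f q (tangent_extension p v q)) p v' *: Z p
     + (dfun f p v *: nabla Z p v' + dfun f p v' *: nabla Z p v)
     + (f p : R) *: nabla (fun q => nabla Z q (tangent_extension p v q)) p v'.
  have sd := @smooth_dfun_tangent_extension _ _ _ O p f v oO (fun _ x => x) sf.
  have sC := smooth_cov oO (sE v) sZ.
  rewrite (@cov_local O p (fun q => (dfun f q (tangent_extension p v q) : R) *: Z q
      + (f q : R) *: nabla Z q (tangent_extension p v q))) //.
  - rewrite (cov_add oO Op).
    + rewrite (cov_scale oO Op _ sd sZ) (cov_scale oO Op _ sf sC).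
      by rewrite !tangent_extension_id !addrA.
    + exact: smooth_fieldZ.
    + exact: smooth_fieldZ.
  - by apply: smooth_fieldD => //; exact: smooth_fieldZ.
  - by move=> q Oq; rewrite (cov_scale oO Oq _ sf sZ).
rewrite /second_cov_commutator !H.
rewrite (@dfun2_sym _ _ _ O p f w u oO (fun _ x => x) Op sf).
rewrite opprD addrACA [dfun f p u *: _ + _]addrC subrr add0r scalerBr//.
Qed.

(** Makes the curvature available through any smooth extension Z, in particular a horizontal one, on
    which the formula for nabla phi can be used. *)
Lemma second_cov_commutator_curvature u w Z : smooth_field O Z ->
  second_cov_commutator p u w Z = curvature nabla p u w (Z p).
Proof.
move=> sZ; rewrite curvatureE.
apply: (@tensoriality O p (second_cov_commutator p u w) oO (fun _ x => x) Op _ _ _ _ _ sZ (sE _)).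
- move=> X Y sX XY; rewrite /second_cov_commutator.
  have H v : nabla (fun q => nabla Y q (tangent_extension p v q)) p
     = nabla (fun q => nabla X q (tangent_extension p v q)) p.
    apply: (cov_local oO Op); first exact: smooth_cov.
    by move=> q Oq; rewrite (cov_local oO Oq sX XY).
  by rewrite !H.
- exact: second_cov_commutatorD.
- exact: second_cov_commutatorZ.
- by rewrite tangent_extension_id.
Qed.

Lemma curvature_anti u w z : curvature nabla p u w z = - curvature nabla p w u z.
Proof. by rewrite !curvatureE opprB. Qed.

Lemma curvatureDl u u' w z : curvature nabla p (u + u') w z
  = curvature nabla p u w z + curvature nabla p u' w z.
Proof.
rewrite !curvatureE /second_cov_commutator linearD.
have -> : (fun q => nabla (tangent_extension p z) q (tangent_extension p (u + u') q))
  = (fun q => nabla (tangent_extension p z) q (tangent_extension p u q)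
      + nabla (tangent_extension p z) q (tangent_extension p u' q)).
  by apply/funext => q; rewrite tangent_extensionD linearD.
by rewrite (cov_add oO Op); [rewrite opprD addrACA|exact: smooth_cov..].
Qed.

Lemma curvatureDm u w w' z : curvature nabla p u (w + w') z
  = curvature nabla p u w z + curvature nabla p u w' z.
Proof.
apply: etrans (curvature_anti u (w + w') z) _.
apply: etrans (congr1 -%R (curvatureDl w w' u z)) _; apply: etrans (opprD _ _) _.
exact: (congr2 +%R (esym (curvature_anti u w z)) (esym (curvature_anti u w' z))).
Qed.

Lemma curvatureDr u w z z' : curvature nabla p u w (z + z')
  = curvature nabla p u w z + curvature nabla p u w z'.
Proof.
rewrite !curvatureE; apply: etrans (second_cov_commutatorD u w (sE z) (sE z')).
by congr (second_cov_commutator _ _ _ _); apply/funext => q; rewrite tangent_extensionD.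
Qed.

Lemma curvatureZr (a : R) u w z :
  curvature nabla p u w (a *: z) = a *: curvature nabla p u w z.
Proof.
rewrite !curvatureE.
apply: etrans (second_cov_commutatorZ u w (smooth_fun_cst a oO) (sE z)).
by congr (second_cov_commutator _ _ _ _); apply/funext => q; rewrite tangent_extensionZ.
Qed.

Lemma curvatureZl (a : R) u w z :
  curvature nabla p (a *: u) w z = a *: curvature nabla p u w z.
Proof.
rewrite !curvatureE /second_cov_commutator linearZ /=.
have -> : (fun q => nabla (tangent_extension p z) q (tangent_extension p (a *: u) q))
  = (fun q => a *: nabla (tangent_extension p z) q (tangent_extension p u q)).
  by apply/funext => q; rewrite tangent_extensionZ linearZ.
rewrite (cov_scale oO Op w (smooth_fun_cst a oO)); last exact: smooth_cov.
by rewrite dfun_cst scale0r add0r scalerBr.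
Qed.

Lemma curvatureZm (a : R) u w z :
  curvature nabla p u (a *: w) z = a *: curvature nabla p u w z.
Proof.
apply: etrans (curvature_anti u (a *: w) z) _.
apply: etrans (congr1 -%R (curvatureZl a w u z)) _.
apply: etrans (esym (scalerN _ _)) _.
exact: (congr1 (fun y => a *: y) (esym (curvature_anti u w z))).
Qed.

(** Away from p the bracket is computed in [chart_at q], where the components of the two fields are
    no longer constant: they are differentials of the transition map t, and the bracket is the
    antisymmetrization of its second differential. *)
Lemma lie_bracket_tangent_extension_near u w q : O q ->
  lie_bracket (tangent_extension p w) (tangent_extension p u) q = 0.
Proof.
move=> Oq.
pose s := transition (chart_at q) (chart_at p).
pose t := transition (chart_at p) (chart_at q).
pose U := chart_image (chart_at q) O.
have oU : open U by exact: open_chart_image.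
pose U' := chart_image (chart_at p) (chart_dom (chart_at q)).
have oU' : open U' by exact: open_chart_image (chart_dom_open _).
have qq := chart_atP q.
have sq : s (map_at q q) = map_at p q by exact: transition_map.
have ds : differentiable s (map_at q q) by exact: differentiable_transition.
have d2t a : differentiable (fun y => 'd t y a) (s (map_at q q)).
  rewrite sq; apply: ((Ck_transition 2 (chart_at p) (chart_at q)).2 a).1.
  by apply: chart_image_map.
have E a b : 'd (field_in_chart (chart_at q) (tangent_extension p a)) (map_at q q)
    (tangent_extension p b q) = 'd (fun y => 'd t y a) (map_at p q) b.
  have N : {near map_at q q, forall x, ((fun y => 'd t y a) \o s) x
      = field_in_chart (chart_at q) (tangent_extension p a) x}.
    have := chart_nbhs _ oO qq Oq.
    apply: filterS => x /chart_imageP[qx Ox xE].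
    apply: esym; apply: etrans (components_tangent_extension _ qx Ox) _.
    by [].
  apply: etrans (congr1 (@^~ (tangent_extension p b q)) (near_eq_diff N (differentiable_comp ds (d2t a)))) _.
  apply: etrans (congr1 (@^~ (tangent_extension p b q)) (diff_comp ds (d2t a))) _.
  have db : 'd s (map_at q q) (tangent_extension p b q) = b.
    exact: etrans (diff_transition_comp b Oq qq Oq) (diff_transition_id b Oq).
  exact: (congr2 (fun x y => 'd (fun z => 'd t z a) x y) sq db).
rewrite /lie_bracket; apply: etrans (congr2 (fun x y => x - y) (E u w) (E w u)) _.
apply/eqP; rewrite subr_eq0; apply/eqP.
apply: (diff2_sym_row _ _ oU' (Ck_transition 2 (chart_at p) (chart_at q))).
exact: chart_image_map.
Qed.

Variable g : riemannian_metric M.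
Hypothesis lc : levi_civita g nabla.

Lemma cov_tangent_extension_sym u w q : O q ->
  nabla (tangent_extension p u) q (tangent_extension p w q)
  = nabla (tangent_extension p w) q (tangent_extension p u q).
Proof.
move=> Oq; apply/eqP; rewrite -subr_eq0; apply/eqP.
rewrite (torsion_free lc (smooth_field_at_open oO Oq (sE w)) (smooth_field_at_open oO Oq (sE u))).
exact: lie_bracket_tangent_extension_near.
Qed.

(** Torsion-freeness and commuting extensions make nabla_b a symmetric in a and b near p, so the six
    second covariant derivatives cancel in pairs. *)
Lemma curvature_bianchi u v w :
  curvature nabla p u v w + curvature nabla p v w u + curvature nabla p w u v = 0.
Proof.
pose F a b c := nabla (fun q => nabla (tangent_extension p a) q (tangent_extension p b q)) p c.
have Fsym a b c : F a b c = F b a c.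
  rewrite /F; congr (fun_of_lfun _ c); apply: (cov_local oO Op).
    exact: smooth_cov.
  by move=> q Oq; exact: cov_tangent_extension_sym.
have E a b c : curvature nabla p a b c = F c b a - F c a b by exact: curvatureE.
rewrite (E u v w) (E v w u) (E w u v).
rewrite (Fsym w v u) (Fsym w u v) (Fsym u v w).
by rewrite !addrA !subrK subrr.
Qed.

Lemma dfun_inner O' Y Z q v : open O' -> O' q -> smooth_field O' Y -> smooth_field O' Z ->
  dfun (fun r => inner g r (Y r) (Z r) : R^o) q v
  = inner g q (nabla Y q v) (Z q) + inner g q (Y q) (nabla Z q v).
Proof.
move=> oO' O'q sY sZ; apply: (metric_compatible lc).
  exact: (smooth_field_at_open oO' O'q sY).
exact: (smooth_field_at_open oO' O'q sZ).
Qed.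

Lemma smooth_inner O' Y Z : open O' -> smooth_field O' Y -> smooth_field O' Z ->
  smooth_fun O' (fun r => inner g r (Y r) (Z r) : R^o).
Proof. by move=> oO' sY sZ; exact: (metric_smooth g oO' sY sZ). Qed.

(** The second derivatives of the function <Y, Z> along u and w commute. Expanded by metric
    compatibility, the products of first covariant derivatives are symmetric in u and w, and what
    remains is the claim. *)
Lemma curvature_skew u w y z :
  inner g p (curvature nabla p u w y) z = - inner g p (curvature nabla p u w z) y.
Proof.
pose Y := tangent_extension p y; pose Z := tangent_extension p z.
pose f q : R^o := inner g q (Y q) (Z q).
have sf : smooth_fun O f := smooth_inner oO (sE y) (sE z).
pose C X v q := nabla X q (tangent_extension p v q).
have sC X v : smooth_field O X -> smooth_field O (C X v) := smooth_cov oO (sE v).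
have H v v' : dfun (fun q => dfun f q (tangent_extension p v q)) p v'
   = (inner g p (nabla (C Y v) p v') z + inner g p (nabla Y p v) (nabla Z p v'))
     + (inner g p (nabla Y p v') (nabla Z p v) + inner g p y (nabla (C Z v) p v')).
  have sYC := smooth_inner oO (sC _ v (sE y)) (sE z).
  have sCZ := smooth_inner oO (sE y) (sC _ v (sE z)).
  have E q : O q -> (inner g q (C Y v q) (Z q) : R^o) + inner g q (Y q) (C Z v q)
      = dfun f q (tangent_extension p v q).
    by move=> Oq; rewrite (dfun_inner _ oO Oq (sE y) (sE z)).
  rewrite (dfun_local oO Op E (smooth_funD oO sYC sCZ)) (dfunD _ oO Op sYC sCZ).
  rewrite (dfun_inner _ oO Op (sC _ v (sE y)) (sE z)).
  rewrite (dfun_inner _ oO Op (sE y) (sC _ v (sE z))).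
  by rewrite /C /Y /Z !tangent_extension_id.
have := @dfun2_sym _ _ _ O p f w u oO (fun _ x => x) Op sf.
rewrite !H.
have E a : curvature nabla p u w a = nabla (C (tangent_extension p a) w) p u
   - nabla (C (tangent_extension p a) u) p w by exact: curvatureE.
rewrite (E y) (E z) -/Y -/Z !innerBl.
rewrite (innerC g p (nabla (C Z w) p u) y) (innerC g p (nabla (C Z u) p w) y).
lra.
Qed.

End CurvatureField.
End Connection.

(** * The algebraic identity *)

Section Functionals.
Context {R : realType} {m : nat}.
Local Notation T := 'rV[R]_m.

Lemma dim_regular_img (U : {vspace T}) (f : 'Hom(T, R^o)) :
  (\dim (f @: U) <= 1)%N.
Proof. by rewrite (leq_trans (dimvS (subvf _)))// dimvf /= /dim /=. Qed.

(** Each functional lowers the dimension by at most one. With the empty list this merely picks a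
    nonzero vector of U. *)
Lemma exists_common_zero (U : {vspace T}) (fs : seq 'Hom(T, R^o)) :
  (size fs < \dim U)%N ->
  exists x, [/\ x \in U, x != 0 & forall f, f \in fs -> f x = 0].
Proof.
elim: fs U => [|f fs IH] U /= sU.
  exists (vpick U); split=> //; first exact: memv_pick.
  by rewrite vpick0 -dimv_eq0 -lt0n.
have [|x [xU x0 fx]] := IH (U :&: lker f)%VS.
  have := limg_ker_dim f U; have := dim_regular_img U f.
  move: sU; move: (\dim _) (\dim _) (\dim _) (size _) => a b c d.
  by move=> H1 H2 H3; move: H1; rewrite -H3 => H1; rewrite -(ltn_add2r 1) addn1 (leq_trans H1)// leq_add2l.
move: xU; rewrite memv_cap memv_ker => /andP[xU /eqP fx0].
exists x; split=> // h; rewrite inE => /orP[/eqP -> //|]; exact: fx.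
Qed.

Lemma dim_cap_lker_lt (U : {vspace T}) (f : 'Hom(T, R^o)) x :
  x \in U -> f x != 0 -> (\dim (U :&: lker f) < \dim U)%N.
Proof.
move=> xU fx; rewrite -(limg_ker_dim f U) -[X in (X < _)%N]addn0 ltn_add2l.
rewrite lt0n dimv_eq0; apply: contra_neq fx => fU.
by apply/eqP; rewrite -memv0 -fU memv_img.
Qed.

Lemma dim_lker_form (f : 'Hom(T, R^o)) x : f x != 0 -> (\dim (lker f)).+1 = m.
Proof.
move=> fx; have := dim_cap_lker_lt (memvf x) fx.
have := dim_regular_img fullv f; have := limg_ker_dim f fullv.
have dm : \dim (fullv : {vspace T}) = m by rewrite dimvf /dim /= mul1n.
rewrite capfv => E b1 lt; apply: etrans dm; move: b1 lt; rewrite -E.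
case: (\dim (f @: _)) => [|[|//]] _; last by rewrite addn1.
by rewrite addn0 ltnn.
Qed.

End Functionals.

(** The matrix with entries a_i b_j + c_i d_j has rank at most 2, so its determinant vanishes; here
    it is diagonal with entries x1, x2, x3. *)
Lemma rank2_diagonal3 (R : comRingType) (a1 a2 a3 b1 b2 b3 : R)
    (c1 c2 c3 d1 d2 d3 x1 x2 x3 : R) :
  x1 = a1 * b1 + c1 * d1 -> 0 = a1 * b2 + c1 * d2 -> 0 = a1 * b3 + c1 * d3 ->
  0 = a2 * b1 + c2 * d1 -> x2 = a2 * b2 + c2 * d2 -> 0 = a2 * b3 + c2 * d3 ->
  0 = a3 * b1 + c3 * d1 -> 0 = a3 * b2 + c3 * d2 -> x3 = a3 * b3 + c3 * d3 ->
  x1 * x2 * x3 = 0.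
Proof.
set m11 := (X in x1 = X); set m12 := (X in 0 = X); move=> E11 E12.
set m13 := (X in 0 = X); set m21 := (X in _ -> 0 = X -> _ = a2 * b2 + _ -> _) => E13 E21.
set m22 := (X in x2 = X); set m23 := (X in 0 = X) => E22 E23.
set m31 := (X in 0 = X) => E31; set m32 := (X in 0 = X); set m33 := (X in x3 = X) => E32 E33.
rewrite E11 E22 E33.
(* The right-hand side is m11 m22 m33 minus the determinant, which is identically 0. *)
have -> : m11 * m22 * m33
   = m11 * (m23 * m32) + m12 * (m21 * m33 - m23 * m31) - m13 * (m21 * m32 - m22 * m31).
  by rewrite /m11 /m12 /m13 /m21 /m22 /m23 /m31 /m32 /m33; ring.
by rewrite -E12 -E13 -E23; ring.
Qed.

(** * Linear algebra of the identity relating q, A, w and b *)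

Section AntilinearIdentity.
Context {R : realType} {m : nat} {M : manifold R m} (g : riemannian_metric M).
Variables (p : M) (D : {vspace 'rV[R]_m}) (J A : 'End('rV[R]_m)).
Local Notation T := 'rV[R]_m.
Local Notation ip := (inner g p).
Variables (b : T -> T -> R) (c : R).
Hypotheses (J_D : forall u, u \in D -> J u \in D)
  (A_D : forall u, u \in D -> A u \in D)
  (JJ : forall u, u \in D -> J (J u) = - u)
  (ipJ : forall u v, u \in D -> v \in D -> ip (J u) (J v) = ip u v)
  (AJ : forall u, u \in D -> A (J u) = - J (A u)).

Definition skew_part (u v : T) : R := ip (A u) v - ip (A v) u.

Definition complex_wedge (W X Y Z : T) : R :=
  ip W Y * ip X Z - ip X Y * ip W Z
  - (ip (J W) Y * ip (J X) Z - ip (J X) Y * ip (J W) Z).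

Local Notation w := skew_part.
Local Notation q := complex_wedge.

Hypothesis w_nondeg : forall u, u \in D -> (forall v, v \in D -> w u v = 0) -> u = 0.
Hypothesis wedge_id : forall W X Y Z,
  W \in D -> X \in D -> Y \in D -> Z \in D ->
  c * q (J W) X Y Z = - q (J (A W)) (A X) Y Z + w W X * b Y Z.

Let ipJl u v : u \in D -> v \in D -> ip (J u) v = - ip u (J v).
Proof. by move=> uD vD; rewrite -ipJ ?J_D// JJ// innerNl. Qed.

Let ipJs u : u \in D -> ip u (J u) = 0.
Proof. by move=> uD; have := ipJl uD uD; rewrite innerC; lra. Qed.

Let complex_wedgeJ W X Y Z : W \in D -> X \in D -> Y \in D -> Z \in D ->
  q W X (J Y) Z = - q (J W) X Y Z.
Proof.
move=> WD XD YD ZD; rewrite /complex_wedge JJ// !ipJ// !innerNl.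
by rewrite !ipJl//; ring.
Qed.

Let complex_wedgeNl W X Y Z : q (- W) X Y Z = - q W X Y Z.
Proof. by rewrite /complex_wedge linearN !innerNl; ring. Qed.

(** By [complex_wedgeJ] the value is also q(W, X) at (Y, Z). In this form, for J-orthogonal W and X
    taken also as (Y, Z), only the product <W, W> <X, X> survives. *)
Let complex_wedgeJJ W X Y Z : W \in D -> X \in D -> Y \in D -> Z \in D ->
  q (J W) X (J Y) Z = ip W Y * ip X Z - ip X Y * ip W Z
    - ip X (J Y) * ip (J W) Z + ip W (J Y) * ip (J X) Z.
Proof.
move=> WD XD YD ZD; rewrite /complex_wedge JJ// !ipJ// !innerNl.
by ring.
Qed.

Let JAJ u : u \in D -> J (A (J u)) = A u.
Proof. by move=> uD; rewrite (AJ uD) linearN /= (JJ (A_D uD)) opprK. Qed.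

Lemma skew_partC u v : w u v = - w v u.
Proof. by rewrite /skew_part opprB. Qed.

Lemma skew_partJ u : u \in D -> w u (J u) = 0.
Proof.
move=> uD; rewrite /skew_part AJ// innerNl ipJl ?A_D//; lra.
Qed.

Lemma skew_partJJ u v : u \in D -> w (J (J u)) v = - w u v.
Proof. by move=> uD; rewrite JJ// /skew_part linearN innerNl innerNr; ring. Qed.

(* [wedge_id] and its transform under [W -> J W], [Y -> J Y], added and
   subtracted. *)
Lemma wedge_idJ W X Y Z : W \in D -> X \in D -> Y \in D -> Z \in D ->
  c * q (J W) X Y Z = q (J (A W)) (A X) Y Z + w (J W) X * b (J Y) Z.
Proof.
move=> WD XD YD ZD; have := wedge_id (J_D WD) XD (J_D YD) ZD.
rewrite JJ// complex_wedgeNl complex_wedgeJ// opprK => ->.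
rewrite JAJ// complex_wedgeJ ?A_D// opprK//.
Qed.

Lemma wedge_id_add W X Y Z : W \in D -> X \in D -> Y \in D -> Z \in D ->
  2 * c * q (J W) X Y Z = w W X * b Y Z + w (J W) X * b (J Y) Z.
Proof.
move=> WD XD YD ZD; have := wedge_id WD XD YD ZD.
by have := wedge_idJ WD XD YD ZD; lra.
Qed.

Lemma wedge_id_sub W X Y Z : W \in D -> X \in D -> Y \in D -> Z \in D ->
  2 * q (J (A W)) (A X) Y Z = w W X * b Y Z - w (J W) X * b (J Y) Z.
Proof.
move=> WD XD YD ZD; have := wedge_id WD XD YD ZD.
by have := wedge_idJ WD XD YD ZD; lra.
Qed.

Lemma skew_part_neq0 u : u \in D -> u != 0 -> exists2 v, v \in D & w u v != 0.
Proof.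
move=> uD u0; apply: contrapT => H.
move/eqP: u0; apply; apply: w_nondeg => // v vD.
by apply: contrapT => /eqP wv; apply: H; exists v.
Qed.

(** Since w(e, J e) = 0, a vector X with w(e, X) nonzero cannot lie in the span of e and J e. Three
    nonzero orthogonal vectors result, and cutting D successively by their orthogonal hyperplanes
    lowers the dimension three times. *)
Lemma dim_D_gt2 : (0 < \dim D)%N -> (2 < \dim D)%N.
Proof.
move=> D0; have [e [eD e0 _]] := exists_common_zero (U := D) (fs := [::]) D0.
have [X XD wX] := skew_part_neq0 eD e0.
have n0 : ip e e != 0 by rewrite gt_eqF// inner_gt0.
(* The component of X orthogonal to e and J e, which have the same norm; w(e, -) does not see the
   part removed. *)
pose X0 := X - (ip X e / ip e e) *: e - (ip X (J e) / ip e e) *: J e.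
have JeD := J_D eD.
have X0D : X0 \in D by rewrite !rpredB// rpredZ.
have eX0 : ip e X0 = 0.
  rewrite innerC /X0 !innerBl !innerZl [ip (J e) e]innerC ipJs// mulr0 subr0.
  by rewrite divfK// subrr.
have JeX0 : ip (J e) X0 = 0.
  rewrite innerC /X0 !innerBl !innerZl ipJs// mulr0 subr0 ipJ//.
  by rewrite divfK// subrr.
have wX0 : w e X0 = w e X.
  have wD a d : w e (a + d) = w e a + w e d.
    by rewrite /skew_part linearD innerDl innerDr; ring.
  have wZ k a : w e (k *: a) = k * w e a.
    by rewrite /skew_part linearZ innerZl innerZr; ring.
  have wee : w e e = 0 by rewrite /skew_part subrr.
  by rewrite /X0 -!scaleNr !wD !wZ skew_partJ// wee !mulr0 !addr0.
have X00 : X0 != 0.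
  apply: contra_neq wX => X00.
  by rewrite -wX0 X00 /skew_part linear0 inner0l inner0r subrr.
have fJe : g p (J e) (J e) != 0 by rewrite -[_ _ (J e)]/(ip _ _) ipJ.
have fX : g p X0 X0 != 0 by rewrite gt_eqF// [_ < _]inner_gt0.
have JeU : J e \in (D :&: lker (g p e))%VS.
  by rewrite memv_cap JeD memv_ker; apply/eqP; exact: ipJs.
have XU : X0 \in ((D :&: lker (g p e)) :&: lker (g p (J e)))%VS.
  by rewrite !memv_cap X0D !memv_ker; apply/andP; split; [|apply/eqP]; first exact/eqP.
have h1 := dim_cap_lker_lt eD (n0 : g p e e != 0).
have h2 := dim_cap_lker_lt JeU fJe.
have h3 := dim_cap_lker_lt XU fX.
exact: leq_ltn_trans (leq_ltn_trans (leq_ltn_trans (leq0n _) h3) h2) h1.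
Qed.

Lemma orthogonal_frame2 : (2 < \dim D)%N -> exists e1 e2,
  [/\ e1 \in D, e2 \in D, e1 != 0, e2 != 0 & ip e2 e1 = 0 /\ ip e2 (J e1) = 0].
Proof.
move=> D2; have D0 : (0 < \dim D)%N by exact: leq_trans D2.
have [e1 [e1D e10 _]] := exists_common_zero (U := D) (fs := [::]) D0.
have [e2 [e2D e20 H]] := exists_common_zero (U := D) (fs := [:: g p e1; g p (J e1)]) D2.
exists e1, e2; split=> //; split; rewrite innerC; apply: H; by rewrite !inE eqxx ?orbT.
Qed.

(** If dim D > 4 there are nonzero e1, e2, e3 spanning mutually orthogonal J-lines. [wedge_id_add],
    with J Y for Y and both (W, X) and (Y, Z) among the pairs (e1, e2), (e1, e3), (e2, e3), gives a
    diagonal 3 by 3 matrix with entries 2c |W|^2 |X|^2. Its right-hand side is a sum of two matrices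
    of rank at most one, contradicting [rank2_diagonal3]. *)
Lemma dim_D_le4 : c != 0 -> (\dim D <= 4)%N.
Proof.
move=> c0; rewrite leqNgt; apply/negP => D4.
have D2 : (2 < \dim D)%N by exact: leq_trans D4.
have [e1 [e2 [e1D e2D e10 e20 [e21 e2J1]]]] := orthogonal_frame2 D2.
have [e3 [e3D e30 H]] := exists_common_zero (U := D)
  (fs := [:: g p e1; g p (J e1); g p e2; g p (J e2)]) D4.
have e31 : ip e3 e1 = 0 by rewrite innerC; apply: H; rewrite !inE eqxx ?orbT.
have e3J1 : ip e3 (J e1) = 0 by rewrite innerC; apply: H; rewrite !inE eqxx ?orbT.
have e32 : ip e3 e2 = 0 by rewrite innerC; apply: H; rewrite !inE eqxx ?orbT.
have e3J2 : ip e3 (J e2) = 0 by rewrite innerC; apply: H; rewrite !inE eqxx ?orbT.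
have e12 : ip e1 e2 = 0 by rewrite innerC.
have e13 : ip e1 e3 = 0 by rewrite innerC.
have e23 : ip e2 e3 = 0 by rewrite innerC.
have e1J2 : ip e1 (J e2) = 0 by rewrite innerC ipJl// e2J1 oppr0.
have e1J3 : ip e1 (J e3) = 0 by rewrite innerC ipJl// e3J1 oppr0.
have e2J3 : ip e2 (J e3) = 0 by rewrite innerC ipJl// e3J2 oppr0.
have J12 : ip (J e1) e2 = 0 by rewrite innerC.
have J13 : ip (J e1) e3 = 0 by rewrite innerC.
have J23 : ip (J e2) e3 = 0 by rewrite innerC.
have J11 := ipJs e1D; have J22 := ipJs e2D; have J33 := ipJs e3D.
have J2' : ip (J e2) e2 = 0 by rewrite innerC.
have J3' : ip (J e3) e3 = 0 by rewrite innerC.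
have n1 : 0 < ip e1 e1 by exact: inner_gt0.
have n2 : 0 < ip e2 e2 by exact: inner_gt0.
have n3 : 0 < ip e3 e3 by exact: inner_gt0.
have E W X Y Z (WD : W \in D) (XD : X \in D) (YD : Y \in D) (ZD : Z \in D) :
    2 * c * (ip W Y * ip X Z - ip X Y * ip W Z
    - ip X (J Y) * ip (J W) Z + ip W (J Y) * ip (J X) Z)
    = w W X * b (J Y) Z + w (J W) X * b (J (J Y)) Z.
  by rewrite -complex_wedgeJJ//; apply: wedge_id_add => //; exact: J_D.
have E11 := E _ _ _ _ e1D e2D e1D e2D; have E12 := E _ _ _ _ e1D e2D e1D e3D.
have E13 := E _ _ _ _ e1D e2D e2D e3D; have E21 := E _ _ _ _ e1D e3D e1D e2D.
have E22 := E _ _ _ _ e1D e3D e1D e3D; have E23 := E _ _ _ _ e1D e3D e2D e3D.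
have E31 := E _ _ _ _ e2D e3D e1D e2D; have E32 := E _ _ _ _ e2D e3D e1D e3D.
have E33 := E _ _ _ _ e2D e3D e2D e3D.
move: E11 E12 E13 E21 E22 E23 E31 E32 E33.
rewrite !(e12, e13, e23, e21, e31, e32, e1J2, e1J3, e2J3, e2J1, e3J1, e3J2).
rewrite !(J12, J13, J23, J11, J22, J33, J2', J3').
rewrite !(mul0r, mulr0, subr0, addr0).
move=> E11 E12 E13 E21 E22 E23 E31 E32 E33.
have := rank2_diagonal3 E11 E12 E13 E21 E22 E23 E31 E32 E33.
by apply/eqP; rewrite !mulf_neq0// ?pnatr_eq0// gt_eqF.
Qed.

Lemma b_eq0 : c = 0 -> (0 < \dim D)%N -> forall Y Z, Y \in D -> Z \in D -> b Y Z = 0.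
Proof.
move=> c0 D0 Y Z YD ZD.
have [W [WD W0 _]] := exists_common_zero (U := D) (fs := [::]) D0.
have [X XD wX] := skew_part_neq0 WD W0.
have E1 := wedge_id_add WD XD YD ZD.
have E2 := wedge_id_add (J_D WD) XD YD ZD.
rewrite skew_partJJ// c0 mulr0 !mul0r in E1 E2.
(* The identities for W and J W form a linear system in b(Y, Z) and b(J Y, Z); up to sign its
   determinant is this sum of squares, positive because w(W, X) is nonzero. *)
have : (w W X ^+ 2 + w (J W) X ^+ 2) * b Y Z = 0.
  rewrite mulrDl !expr2 -!mulrA.
  have -> : w W X * b Y Z = - (w (J W) X * b (J Y) Z) by lra.
  have -> : w (J W) X * b Y Z = w W X * b (J Y) Z by lra.
  ring.
move/eqP; rewrite mulf_eq0 => /orP[|/eqP//].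
by rewrite gt_eqF// ltr_wpDr ?sqr_ge0// exprn_even_gt0.
Qed.

(** * The case c = 0 *)

Section Flat.
Hypotheses (c0 : c = 0) (D0 : (0 < \dim D)%N).

Lemma exists_A_neq0 : exists2 X, X \in D & A X != 0.
Proof.
have [W [WD W0 _]] := exists_common_zero (U := D) (fs := [::]) D0.
have [X XD wX] := skew_part_neq0 WD W0.
have [AW|AW] := eqVneq (A W) 0; last by exists W.
exists X => //; apply: contra_neq wX => AX.
by rewrite /skew_part AW AX !inner0l subrr.
Qed.

Lemma wedge_A_eq0 W X Y Z : W \in D -> X \in D -> Y \in D -> Z \in D ->
  q (J (A W)) (A X) Y Z = 0.
Proof.
move=> WD XD YD ZD; have := wedge_id_sub WD XD YD ZD.
rewrite !(b_eq0 c0 D0)// ?J_D//; lra.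
Qed.

(* The image of [A] is contained in the complex line of any nonzero [A W]. *)
Lemma A_orthogonal W X Z : W \in D -> X \in D -> Z \in D -> A W != 0 ->
  (ip (A X) (A W) = 0 -> ip (A X) (J (A W)) = 0 -> A X = 0)
  /\ (ip Z (A W) = 0 -> ip Z (J (A W)) = 0 -> ip (A X) Z = 0).
Proof.
move=> WD XD ZD AW0; have AWD := A_D WD; have AXD := A_D XD.
have n0 : ip (A W) (A W) != 0 by rewrite gt_eqF// inner_gt0.
have E V : V \in D -> ip (A W) (A W) * ip (A X) V
     = ip (A X) (J (A W)) * ip (J (A W)) V + ip (A X) (A W) * ip (A W) V.
  move=> VD; have := wedge_A_eq0 WD XD (J_D AWD) VD.
  rewrite complex_wedgeJJ// ipJs//; lra.
split=> [X1 X2|Z1 Z2].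
  apply: (inner_eq0 (g := g) (p := p)); apply: (mulfI n0).
  by rewrite E// X1 X2 !mul0r addr0 mulr0.
apply: (mulfI n0); rewrite E// mulr0 (innerC g p (A W)) Z1 (innerC g p (J _)) Z2.
by rewrite !mulr0 addr0.
Qed.

(** Two functionals make A X orthogonal to A W and J A W; as A X lies in the complex line of A W, it
    vanishes. *)
Lemma exists_A_kernel : (2 < \dim D)%N -> exists X, [/\ X \in D, X != 0 & A X = 0].
Proof.
move=> D2; have [W WD AW] := exists_A_neq0.
have [X [XD X0 H]] := exists_common_zero (U := D)
  (fs := [:: (g p (A W) \o A)%VF; (g p (J (A W)) \o A)%VF]) D2.
exists X; split=> //; apply: (A_orthogonal WD XD XD AW).1.
  have := H (g p (A W) \o A)%VF; rewrite comp_lfunE innerC; apply.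
  by rewrite !inE eqxx.
have := H (g p (J (A W)) \o A)%VF; rewrite comp_lfunE innerC; apply.
by rewrite !inE eqxx orbT.
Qed.

(** Four functionals put X both in the kernel of A and orthogonal to the image A(D), so the two
    terms of w(X, V) vanish for every V in D, against nondegeneracy. *)
Lemma dim_D_le4_flat : (\dim D <= 4)%N.
Proof.
rewrite leqNgt; apply/negP => D4; have [W WD AW] := exists_A_neq0.
have [X [XD X0 H]] := exists_common_zero (U := D)
  (fs := [:: (g p (A W) \o A)%VF; (g p (J (A W)) \o A)%VF; g p (A W); g p (J (A W))]) D4.
have AX : A X = 0.
  apply: (A_orthogonal WD XD XD AW).1.
    have := H (g p (A W) \o A)%VF; rewrite comp_lfunE innerC; apply.
    by rewrite !inE eqxx.
  have := H (g p (J (A W)) \o A)%VF; rewrite comp_lfunE innerC; apply.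
  by rewrite !inE eqxx !orbT.
have X1 : ip X (A W) = 0 by rewrite innerC; apply: H; rewrite !inE eqxx !orbT.
have X2 : ip X (J (A W)) = 0 by rewrite innerC; apply: H; rewrite !inE eqxx !orbT.
move/eqP: X0; apply; apply: w_nondeg => // V VD.
by rewrite /skew_part AX inner0l (A_orthogonal WD VD XD AW).2// subrr.
Qed.

End Flat.

(** If A X = 0 but w(W', X) is nonzero, the left side of [wedge_id_sub] vanishes; at W' and J W' it
    then forces b = 0 on D. But then [wedge_id_add] on two J-orthogonal vectors, available since dim
    D > 2, reads 2c |e1|^2 |e2|^2 = 0. *)
Lemma A_injective : c != 0 -> (2 < \dim D)%N ->
  forall X, X \in D -> A X = 0 -> X = 0.
Proof.
move=> c0 D2 X XD AX; apply: w_nondeg => // W' W'D; rewrite skew_partC.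
have [e1 [e2 [e1D e2D e10 e20 [e21 e2J1]]]] := orthogonal_frame2 D2.
apply/eqP; rewrite oppr_eq0; apply: contraT => wX.
have E Y Z W : W \in D -> Y \in D -> Z \in D -> w W X * b Y Z = w (J W) X * b (J Y) Z.
  move=> WD YD ZD; have := wedge_id_sub WD XD YD ZD.
  by rewrite AX /complex_wedge linear0 !inner0l; lra.
have b0 Y Z : Y \in D -> Z \in D -> b Y Z = 0.
  move=> YD ZD; have E1 := E Y Z W' W'D YD ZD.
  have E2 := E Y Z (J W') (J_D W'D) YD ZD; rewrite skew_partJJ// in E2.
  have : (w W' X ^+ 2 + w (J W') X ^+ 2) * b Y Z = 0.
    by rewrite mulrDl !expr2 -!mulrA E1 E2; ring.
  move/eqP; rewrite mulf_eq0 => /orP[|/eqP//].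
  by rewrite gt_eqF// ltr_wpDr ?sqr_ge0// exprn_even_gt0.
have := wedge_id_add e1D e2D (J_D e1D) e2D.
rewrite !b0 ?J_D// complex_wedgeJJ// e21 e2J1 !mulr0 !mul0r addr0 subr0.
rewrite (ipJs e1D) mul0r addr0 subr0 => /eqP.
by rewrite !mulf_eq0 pnatr_eq0 (negPf c0) !gt_eqF ?inner_gt0.
Qed.

Lemma antilinear_identity_dim : (0 < \dim D)%N -> ~~ odd (\dim D) ->
  \dim D = 4%N /\
  (((A @: D)%VS = D /\ {in D &, injective A}) <-> c <> 0).
Proof.
move=> D0 Deven; have D2 := dim_D_gt2 D0.
have D4 : (\dim D <= 4)%N.
  by have [/dim_D_le4_flat/(_ D0)|/dim_D_le4] := eqVneq c 0.
split.
  (* Only 3 and 4 are left, and parity excludes 3. *)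
  by move: D2 D4 Deven; case: (\dim D) => [|[|[|[|[|]]]]].
split=> [[_ Ainj] c0|/eqP c0].
  have [X [XD X0 AX]] := exists_A_kernel c0 D0 D2.
  by move/eqP: X0; apply; apply: Ainj; rewrite ?mem0v// linear0.
have Ainj := A_injective c0 D2.
have kD : (D :&: lker A = 0)%VS.
  apply/eqP; rewrite -subv0; apply/subvP => X.
  by rewrite memv_cap memv_ker memv0 => /andP[XD /eqP AX]; rewrite (Ainj X).
split.
  apply/eqP; rewrite eqEdim (limg_dim_eq kD) leqnn andbT.
  by apply/subvP => _ /memv_imgP[X XD ->]; exact: A_D.
move=> X Y XD YD AXY; apply/eqP; rewrite -subr_eq0; apply/eqP; apply: Ainj.
  exact: rpredB.
by rewrite linearB /= AXY subrr.
Qed.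

End AntilinearIdentity.

(** * Degenerate contact forms *)

Section Wedge.
Context {R : realType} {V : lmodType R}.

Definition update_arg k (v : 'I_k -> V) (j : 'I_k) (u : V) : 'I_k -> V :=
  fun i => if i == j then u else v i.

Definition multilinear k (f : @kform R V k) := forall v j (a : R) u u',
  f (update_arg v j (a *: u + u')) = a * f (update_arg v j u) + f (update_arg v j u').

(** Like [multilinear], this holds vacuously for k = 0, which starts the inductions on
    [wedge_power]. *)
Definition annihilates k (x : V) (f : @kform R V k) := forall v i, v i = x -> f v = 0.

Variables k l : nat.
Implicit Types (a : @kform R V k) (b : @kform R V l).

Lemma wedge_multilinear a b : multilinear a -> multilinear b -> multilinear (wedge a b).
Proof.
move=> ma mb v j c u u'; rewrite /wedge mulrCA -mulrDr; congr (_ * _).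
rewrite mulr_sumr -big_split /=; apply: eq_bigr => s _.
(* Slot j is read at position j' only, which belongs to exactly one of the two blocks; the other
   factor does not see the change. *)
pose j' := (s^-1)%g j; have sj : s j' = j by rewrite permKV.
have E i : (s i == j) = (i == j') by rewrite -sj (inj_eq perm_inj).
case: (split_ordP j') => i ji.
  have L x : (fun i0 => update_arg v j x (s (lshift l i0)))
     = update_arg (fun i0 => v (s (lshift l i0))) i x.
    by apply/funext => i0; rewrite /update_arg E ji (inj_eq (@lshift_inj _ _)).
  have Rt x : (fun i0 => update_arg v j x (s (rshift k i0)))
     = (fun i0 => v (s (rshift k i0))).
    by apply/funext => i0; rewrite /update_arg E ji eq_rlshift.
  rewrite (L u) (L u') (L (c *: u + u')) (Rt u) (Rt u') (Rt (c *: u + u')) ma.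
  have K (e d x y z : R) : e * (d * x + y) * z = d * (e * x * z) + e * y * z by ring.
  exact: K.
have Rt x : (fun i0 => update_arg v j x (s (rshift k i0)))
   = update_arg (fun i0 => v (s (rshift k i0))) i x.
  by apply/funext => i0; rewrite /update_arg E ji (inj_eq (@rshift_inj _ _)).
have L x : (fun i0 => update_arg v j x (s (lshift l i0)))
   = (fun i0 => v (s (lshift l i0))).
  by apply/funext => i0; rewrite /update_arg E ji eq_lrshift.
rewrite (L u) (L u') (L (c *: u + u')) (Rt u) (Rt u') (Rt (c *: u + u')) mb.
have K (e d x y z : R) : e * x * (d * y + z) = d * (e * x * y) + e * x * z by ring.
exact: K.
Qed.

Lemma wedge_annihilates x a b : annihilates x a -> annihilates x b ->
  annihilates x (wedge a b).
Proof.
move=> na nb v j vj; rewrite /wedge big1 ?mulr0// => s _.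
have sj : s ((s^-1)%g j) = j by rewrite permKV.
case: (split_ordP ((s^-1)%g j)) => i ji; rewrite ji in sj.
  by rewrite (na _ i) ?sj// mulr0 mul0r.
by rewrite (nb _ i) ?sj// mulr0.
Qed.

Lemma wedge_perm a b v (t : 'S_(k + l)) :
  wedge a b (v \o t) = (-1) ^+ t * wedge a b v.
Proof.
rewrite /wedge mulrCA; congr (_ * _); rewrite mulr_sumr.
rewrite [in RHS](reindex_inj (mulIg t)) /=; apply: eq_bigr => s _.
have -> : (fun i => v ((s * t)%g (lshift l i))) = (fun i => (v \o t) (s (lshift l i))).
  by apply/funext => i; rewrite permM.
have -> : (fun i => v ((s * t)%g (rshift k i))) = (fun i => (v \o t) (s (rshift k i))).
  by apply/funext => i; rewrite permM.
rewrite !mulrA odd_permM signr_addb mulrC [in RHS]mulrC; congr (_ * (_ * _)).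
by rewrite mulrCA -signr_addb addbb mulr1.
Qed.

(** The signed sum over all permutations makes the product alternating whatever a and b are:
    swapping two equal arguments leaves v unchanged and reverses the sign. *)
Lemma wedge_alternating a b v i j : i != j -> v i = v j -> wedge a b v = 0.
Proof.
move=> ij vij; have := wedge_perm a b v (tperm i j).
have -> : v \o tperm i j = v.
  by apply/funext => h /=; case: tpermP => [->|->|].
by rewrite odd_tperm ij expr1 mulN1r; lra.
Qed.

End Wedge.

Section ContactForm.
Context {R : realType} {V : lmodType R}.

Lemma multilinear_sum k (f : @kform R V k) v j (I : Type) (r : seq I)
    (c : I -> R) (u : I -> V) : multilinear f ->
  f (update_arg v j (\sum_(i <- r) c i *: u i))
  = \sum_(i <- r) c i * f (update_arg v j (u i)).
Proof.
move=> mf; have f0 : f (update_arg v j 0) = 0.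
  have := mf v j (-1) 0 0; rewrite scaler0 addr0; lra.
elim: r => [|i r IH]; first by rewrite !big_nil.
by rewrite !big_cons mf IH.
Qed.

Lemma wedge_power_multilinear (b : V -> V -> R) n :
  (forall c u u' v, b (c *: u + u') v = c * b u v + b u' v) ->
  (forall c u u' v, b v (c *: u + u') = c * b v u + b v u') ->
  multilinear (wedge_power (form2 b) n).
Proof.
move=> bl br; elim: n => [|n IH]; first by move=> v [].
apply: (@wedge_multilinear R V 2 (n * 2) _ _ _ IH) => v j c u u'.
rewrite /form2 /update_arg; case: j => -[|[|//]] jlt /=.
  by rewrite bl.
by rewrite br.
Qed.

Lemma wedge_power_annihilates (b : V -> V -> R) n x :
  (forall v, b x v = 0) -> (forall v, b v x = 0) ->
  annihilates x (wedge_power (form2 b) n).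
Proof.
move=> bl br; elim: n => [|n IH]; first by move=> v [].
apply: (@wedge_annihilates R V 2 (n * 2) _ _ _ _ IH) => v j vj.
rewrite /form2; case: j vj => -[|[|//]] jlt vj.
  have -> : v ord0 = x by rewrite -vj; congr v; apply/val_inj.
  exact: bl.
have -> : v ord_max = x by rewrite -vj; congr v; apply/val_inj.
exact: br.
Qed.

End ContactForm.

(** The vectors v i together with x are 2n + 2 vectors in dimension at most 2n + 1, hence dependent.
    The relation expresses a combination of the v i as a multiple of x, on which the form
    vanishes. *)
Lemma degenerate_contact_eq0 (R : realType) (m n : nat) (a : 'rV[R]_m -> R)
    (b : 'rV[R]_m -> 'rV[R]_m -> R) (x : 'rV[R]_m) (v : 'I_(1 + n * 2) -> 'rV[R]_m) :
  (m <= 1 + n * 2)%N ->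
  (forall c u u', a (c *: u + u') = c * a u + a u') ->
  (forall c u u' v, b (c *: u + u') v = c * b u v + b u' v) ->
  (forall c u u' v, b v (c *: u + u') = c * b v u + b v u') ->
  x != 0 -> a x = 0 -> (forall v, b x v = 0) -> (forall v, b v x = 0) ->
  wedge (form1 a) (wedge_power (form2 b) n) v = 0.
Proof.
move=> mn al bl br x0 ax bx xb; set f := wedge _ _.
have mf : multilinear f.
  apply: wedge_multilinear; last exact: wedge_power_multilinear.
  by move=> w j c u u'; rewrite /form1 /update_arg (ord1 j) /= al.
have nf : annihilates x f.
  apply: wedge_annihilates; last exact: wedge_power_annihilates.
  by move=> w j wj; rewrite /form1 -ax -wj (ord1 j).
pose B := col_mx (\matrix_(i < 1 + n * 2) v i) x.
have : kermx B != 0.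
  rewrite -mxrank_eq0 mxrank_ker subn_eq0 -ltnNge.
  by rewrite (leq_ltn_trans (rank_leq_col _))// addn1 ltnS.
case/rowV0Pn => r /sub_kermxP rB r0.
have : \sum_i (lsubmx r) 0 i *: v i = - (rsubmx r 0 0) *: x.
  move: rB; rewrite -[r in r *m _]hsubmxK mul_row_col => /eqP.
  rewrite addr_eq0 => /eqP rB.
  rewrite scaleNr; transitivity (lsubmx r *m \matrix_i v i).
    by rewrite mulmx_sum_row; apply: eq_bigr => i _; rewrite rowK.
  rewrite rB; congr (- _); rewrite mulmx_sum_row big_ord1.
  by congr (_ *: _); apply/rowP => i; rewrite mxE.
(* Otherwise the relation would involve x alone, and be trivial since x is nonzero. *)
move=> E; have [j rj] : exists j, (lsubmx r) 0 j != 0.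
  apply: contrapT => H; move/eqP: r0; apply.
  have l0 : lsubmx r = 0.
    apply/rowP => j; rewrite [RHS]mxE; apply: contrapT => /eqP lj.
    by apply: H; exists j.
  move: E; rewrite big1 => [/esym/eqP|i _]; last by rewrite l0 mxE scale0r.
  rewrite scaler_eq0 (negPf x0) orbF oppr_eq0 => /eqP rx.
  rewrite -[r]hsubmxK l0; have -> : rsubmx r = 0.
    by apply/rowP => i; rewrite (ord1 i) rx [RHS]mxE.
  by rewrite row_mx0.
(* In slot j the combination is a multiple of x, so f vanishes. Expanded linearly, its terms with i
   different from j repeat v i, and the coefficient of index j times f v is what remains. *)
have : f (update_arg v j (\sum_i (lsubmx r) 0 i *: v i)) = 0.
  rewrite E -[_ *: x]addr0 mf.
  rewrite (nf _ j) ?mulr0 ?add0r; last by rewrite /update_arg eqxx.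
  have := mf v j (-1) 0 0; rewrite scaler0 addr0; lra.
rewrite (multilinear_sum _ _ _ _ _ mf) (bigD1 j)//= big1 ?addr0 => [|i ij].
  move/eqP; rewrite mulf_eq0 (negPf rj) => /eqP <-; congr f.
  by apply/funext => i; rewrite /update_arg; case: eqP => // ->.
have -> : f (update_arg v j (v i)) = 0.
  by apply: (wedge_alternating _ _ ij); rewrite /update_arg eqxx (negPf ij).
by rewrite mulr0.
Qed.

(** * Constant sectional curvature *)

Section CurvatureLike.
Context {R : realType} {m : nat}.
Local Notation T := 'rV[R]_m.
Variables (D : {vspace T}) (S : T -> T -> T -> T -> R).
Hypotheses
  (S_add1 : forall a b v w z, S (a + b) v w z = S a v w z + S b v w z)
  (S_add2 : forall a b u w z, S u (a + b) w z = S u a w z + S u b w z)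
  (S_add3 : forall a b u v z, S u v (a + b) z = S u v a z + S u v b z)
  (S_add4 : forall a b u v w, S u v w (a + b) = S u v w a + S u v w b)
  (S_anti12 : forall u v w z, S u v w z = - S v u w z)
  (S_anti34 : forall u v w z, S u v w z = - S u v z w)
  (S_bianchi : forall u v w z, S u v w z + S v w u z + S w u v z = 0).

(** A linear consequence of the four Bianchi identities on cyclic rotations of the arguments and of
    the two antisymmetries. *)
Lemma curvature_like_pair_sym u v w z : S u v w z = S w z u v.
Proof.
have := S_bianchi u v w z; have := S_bianchi v w z u.
have := S_bianchi w z u v; have := S_bianchi z u v w.
have := S_anti34 v w z u; have := S_anti34 w z v u; have := S_anti12 z v w u.
have := S_anti12 z u w v; have := S_anti34 u z w v.
have := S_anti12 u w z v; have := S_anti34 w u z v.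
have := S_anti12 z u v w; have := S_anti34 u v z w; have := S_anti34 v z u w.
lra.
Qed.

Hypothesis S_diag : forall u v, u \in D -> v \in D -> S u v v u = 0.

(** Polarizing in the outer pair gives S(a, b, b, c) = 0, and polarizing in the middle pair gives
    antisymmetry in slots 2 and 3. Combined with antisymmetry in slots 1 and 2, the Bianchi sum
    becomes 3 S(u, v, w, z). *)
Lemma curvature_like_eq0 u v w z : u \in D -> v \in D -> w \in D -> z \in D ->
  S u v w z = 0.
Proof.
have S_diag' a b c : a \in D -> b \in D -> c \in D -> S a b b c = 0.
  move=> aD bD cD; have := S_diag (rpredD aD cD) bD.
  rewrite S_add1 !S_add4 S_diag// S_diag//.
  have := curvature_like_pair_sym c b b a.
  have := S_anti12 b a c b; have := S_anti34 a b c b.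
  lra.
have S_anti23 a b c d : a \in D -> b \in D -> c \in D -> d \in D ->
    S a b c d = - S a c b d.
  move=> aD bD cD dD; have := S_diag' _ _ _ aD (rpredD bD cD) dD.
  rewrite S_add2 !S_add3 !S_diag'//; lra.
move=> uD vD wD zD; have := S_bianchi u v w z.
have := S_anti12 v w u z; have := S_anti23 _ _ _ _ vD uD wD zD.
have := S_anti12 v u w z.
have := S_anti12 w u v z; have := S_anti23 _ _ _ _ uD vD wD zD.
lra.
Qed.

End CurvatureLike.

Section ConstantCurvature.
Context {R : realType} {m : nat} {M : manifold R m} (g : riemannian_metric M).
Variables (p : M) (D : {vspace 'rV[R]_m}) (c : R).
Local Notation T := 'rV[R]_m.
Local Notation ip := (inner g p).
Variable K : T -> T -> T -> T.
Hypotheses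
  (K_add1 : forall a b v w, K (a + b) v w = K a v w + K b v w)
  (K_add2 : forall a b u w, K u (a + b) w = K u a w + K u b w)
  (K_add3 : forall a b u v, K u v (a + b) = K u v a + K u v b)
  (K_scale2 : forall (a : R) u v w, K u (a *: v) w = a *: K u v w)
  (K_scale3 : forall (a : R) u v w, K u v (a *: w) = a *: K u v w)
  (K_anti : forall u v w, K u v w = - K v u w)
  (K_skew : forall u v w z, ip (K u v w) z = - ip (K u v z) w)
  (K_bianchi : forall u v w, K u v w + K v w u + K w u v = 0)
  (K_sec : forall pi : {vspace T}, \dim pi = 2%N -> (pi <= D)%VS ->
    let u := (vbasis pi)`_0 in let v := (vbasis pi)`_1 in
    ip (K u v v) u / (ip u u * ip v v - ip u v ^+ 2) = c).

Lemma gram_neq0 u v : free [:: u; v] -> ip u u * ip v v - ip u v ^+ 2 != 0.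
Proof.
move=> uv; apply/eqP => G0.
have v0 : v != 0 by move: uv; rewrite free_cons seq1_free => /andP[].
have z0 : ip v v *: u - ip u v *: v = 0.
  apply: (inner_eq0 (g := g) (p := p)).
  rewrite !innerBl !innerBr !innerZl !innerZr (innerC g p v u).
  transitivity (ip v v * (ip u u * ip v v - ip u v ^+ 2)); first by ring.
  by rewrite G0 mulr0.
move: uv; rewrite free_cons span_seq1 => /andP[+ _] => /negP; apply.
have n0 : ip v v != 0 by rewrite gt_eqF// inner_gt0.
apply/vlineP; exists ((ip v v)^-1 * ip u v).
move/eqP: z0; rewrite subr_eq0 => /eqP z0.
by rewrite -scalerA -z0 scalerA mulVf// scale1r.
Qed.

Definition curvature_defect u v y z : R :=
  ip (K u v y) z - c * (ip v y * ip u z - ip u y * ip v z).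

Local Notation S := curvature_defect.

Lemma curvature_defectE u v y z : S u v y z =
  ip (K u v y) z - c * (ip v y * ip u z - ip u y * ip v z).
Proof. by []. Qed.

Lemma curvature_defect_add1 a b v w z : S (a + b) v w z = S a v w z + S b v w z.
Proof. by rewrite !curvature_defectE K_add1 !innerDl; ring. Qed.

Lemma curvature_defect_add2 a b u w z : S u (a + b) w z = S u a w z + S u b w z.
Proof. by rewrite !curvature_defectE K_add2 !innerDl; ring. Qed.

Lemma curvature_defect_add3 a b u v z : S u v (a + b) z = S u v a z + S u v b z.
Proof. by rewrite !curvature_defectE K_add3 !innerDl !innerDr; ring. Qed.

Lemma curvature_defect_add4 a b u v w : S u v w (a + b) = S u v w a + S u v w b.
Proof. by rewrite !curvature_defectE !innerDr; ring. Qed.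

Lemma curvature_defect_scale2 a u v w z : S u (a *: v) w z = a * S u v w z.
Proof. by rewrite !curvature_defectE K_scale2 !innerZl; ring. Qed.

Lemma curvature_defect_anti12 u v w z : S u v w z = - S v u w z.
Proof. by rewrite !curvature_defectE K_anti innerNl; ring. Qed.

Lemma curvature_defect_anti34 u v w z : S u v w z = - S u v z w.
Proof. by rewrite !curvature_defectE K_skew; ring. Qed.

Lemma curvature_defect_bianchi u v w z : S u v w z + S v w u z + S w u v z = 0.
Proof.
have := congr1 (fun x => ip x z) (K_bianchi u v w).
rewrite /= !innerDl inner0l !curvature_defectE => H.
rewrite (innerC g p w u) (innerC g p v u) (innerC g p w v).
move: H; move: (ip (K _ _ _) _) (ip (K _ _ _) _) (ip (K _ _ _) _).
by move=> a b d H; rewrite -[RHS]H; ring.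
Qed.

Let S_scale1 a u v w z : S (a *: u) v w z = a * S u v w z.
Proof.
by rewrite curvature_defect_anti12 curvature_defect_scale2
  (curvature_defect_anti12 u) mulrN.
Qed.

Let S_alt12 u w z : S u u w z = 0.
Proof. by have := curvature_defect_anti12 u u w z; lra. Qed.

Let S_alt34 u v w : S u v w w = 0.
Proof. by have := curvature_defect_anti34 u v w w; lra. Qed.

Let S_frame a b d e u v w z :
  S (a *: u + b *: v) (d *: u + e *: v) w z = (a * e - b * d) * S u v w z.
Proof.
rewrite !curvature_defect_add1 !curvature_defect_add2 !S_scale1 !curvature_defect_scale2.
rewrite !S_alt12 (curvature_defect_anti12 v u); ring.
Qed.

(** For independent u, v the curvature hypothesis speaks of the particular basis [vbasis pi] of
    their span; S(u, v, v, u) differs from its value there by the squared determinant of the change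
    of basis. For dependent u, v the antisymmetry alone gives 0. *)
Lemma curvature_defect_diag u v : u \in D -> v \in D -> S u v v u = 0.
Proof.
move=> uD vD; have [uv|] := boolP (free [:: u; v]); last first.
  rewrite free_cons seq1_free span_seq1 negb_and !negbK => /orP[/vlineP[k ->]|/eqP ->].
    by rewrite S_scale1 S_alt12 mulr0.
  by rewrite -[0](scale0r (0 : 'rV[R]_m)) curvature_defect_scale2 mul0r.
pose pi := <<[:: u; v]>>%VS.
have dpi : \dim pi = 2%N by apply/eqP; rewrite -[_ == _]/(free [:: u; v]).
have piD : (pi <= D)%VS.
  by apply/span_subvP => x; rewrite !inE => /orP[|] /eqP ->.
have := K_sec dpi piD.
have [u0 [v0 E]] : exists u0 v0, vbasis pi = [:: u0; v0] :> seq _.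
  have : size (vbasis pi) = 2%N by rewrite size_tuple.
  by case: (tval (vbasis pi)) => [|u0 [|v0 []]]// _; exists u0, v0.
have fr : free [:: u0; v0] by rewrite -E; exact: basis_free (vbasisP pi).
have sp : <<[:: u0; v0]>>%VS = pi by rewrite -E; exact: span_basis (vbasisP pi).
rewrite E /= => secE.
have S0 : S u0 v0 v0 u0 = 0.
  rewrite curvature_defectE -secE (innerC g p v0 u0) [ip v0 v0 * _]mulrC -expr2.
  by rewrite divfK ?subrr// gram_neq0.
have coords x : x \in pi -> exists a b, x = a *: u0 + b *: v0.
  rewrite -sp span_cons span_seq1 => /memv_addP[_ /vlineP[a ->] [_ /vlineP[b ->] ->]].
  by exists a, b.
have [|a [b Eu]] := coords u; first by rewrite memv_span// !inE eqxx.
have [|d [e Ev]] := coords v; first by rewrite memv_span// !inE eqxx orbT.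
rewrite Eu Ev S_frame curvature_defect_anti12 curvature_defect_anti34.
have -> : S v0 u0 (a *: u0 + b *: v0) (d *: u0 + e *: v0)
    = (a * e - b * d) * S v0 u0 u0 v0.
  rewrite !curvature_defect_add4 !curvature_defect_add3.
  have Z3 k x y z t : S x y (k *: z) t = k * S x y z t.
    by rewrite !curvature_defectE K_scale3 !innerZl !innerZr; ring.
  have Z4 k x y z t : S x y z (k *: t) = k * S x y z t.
    by rewrite !curvature_defectE !innerZr; ring.
  rewrite !Z4 !Z3 !S_alt34 (curvature_defect_anti34 _ _ v0 u0); ring.
by rewrite curvature_defect_anti12 curvature_defect_anti34 S0; ring.
Qed.

Lemma constant_curvature u v y z : u \in D -> v \in D -> y \in D -> z \in D ->
  ip (K u v y) z = c * (ip v y * ip u z - ip u y * ip v z).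
Proof.
move=> uD vD yD zD; apply/eqP; rewrite -subr_eq0; apply/eqP.
exact: (curvature_like_eq0 curvature_defect_add1 curvature_defect_add2
  curvature_defect_add3 curvature_defect_add4 curvature_defect_anti12
  curvature_defect_anti34 curvature_defect_bianchi curvature_defect_diag).
Qed.

End ConstantCurvature.

(** * Almost contact metric structures *)

Section AlmostContact.
Context {R : realType} {m : nat} {M : manifold R m}.
Variables (phi : M -> 'End('rV[R]_m)) (xi : M -> 'rV[R]_m)
  (eta : M -> 'Hom('rV[R]_m, R^o)) (g : riemannian_metric M)
  (nabla : affine_connection M).
Local Notation A := (nabla xi).
Hypotheses (acm : almost_contact_metric phi xi eta g) (lc : levi_civita g nabla)
  (anticomm : forall q v, A q (phi q v) + phi q (A q v) = 0)
  (cov_phi_horizontal : forall q u v w, u \in contact_distribution eta q ->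
    v \in contact_distribution eta q -> w \in contact_distribution eta q ->
    g q (cov_endomorphism nabla phi q u v) w = 0).
Implicit Types (p q : M) (u v w x y z : 'rV[R]_m).

Lemma phi2 q v : phi q (phi q v) = - v + (eta q v : R) *: xi q.
Proof. exact: acm_phi2 acm q v. Qed.

(** From phi^2 xi = 0, the formula for phi^2 applied to phi xi shows that phi xi = e xi for a scalar
    e, and then e^2 = 0. *)
Lemma phi_xi q : phi q (xi q) = 0.
Proof.
have xi0 : xi q != 0.
  apply/eqP => x0; have := acm_eta_xi acm q; rewrite x0 linear0 => /eqP.
  by rewrite eq_sym oner_eq0.
have pp : phi q (phi q (xi q)) = 0.
  by rewrite phi2 (acm_eta_xi acm) scale1r addNr.
have [e E] : exists e : R, phi q (xi q) = e *: xi q.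
  exists (eta q (phi q (xi q))).
  have := phi2 q (phi q (xi q)); rewrite pp linear0 => /esym/eqP.
  by rewrite addrC subr_eq0 => /eqP.
move: pp; rewrite E linearZ /= E scalerA => /eqP.
rewrite scaler_eq0 (negPf xi0) orbF mulf_eq0 orbb => /eqP ->.
by rewrite scale0r.
Qed.

Lemma eta_phi q v : (eta q (phi q v) : R) = 0.
Proof.
have xi0 : xi q != 0.
  apply/eqP => x0; have := acm_eta_xi acm q; rewrite x0 linear0 => /eqP.
  by rewrite eq_sym oner_eq0.
have := phi2 q (phi q v); rewrite (phi2 q v) linearD linearN linearZ /= phi_xi scaler0 addr0.
move=> /esym/eqP; rewrite addrC -subr_eq0 opprK subrK scaler_eq0 (negPf xi0) orbF.
by move/eqP.
Qed.

Lemma inner_phi q u v : inner g q (phi q u) (phi q v)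
  = inner g q u v - (eta q u : R) * (eta q v : R).
Proof. exact: acm_metric acm q u v. Qed.

Lemma etaE q v : (eta q v : R) = inner g q v (xi q).
Proof.
have := inner_phi q v (xi q); rewrite phi_xi inner0r (acm_eta_xi acm) mulr1.
by move/esym/eqP; rewrite subr_eq0 => /eqP ->.
Qed.

Lemma inner_xi q : inner g q (xi q) (xi q) = 1.
Proof. by rewrite -etaE; exact: acm_eta_xi acm q. Qed.

Lemma inner_phi_xi q v : inner g q (phi q v) (xi q) = 0.
Proof. by rewrite -etaE eta_phi. Qed.

Lemma phi_skew q u v : inner g q (phi q u) v = - inner g q u (phi q v).
Proof.
have := inner_phi q u (phi q v); rewrite eta_phi mulr0 subr0 phi2 innerDr innerNr innerZr.
by rewrite inner_phi_xi mulr0 addr0 => /eqP; rewrite eqr_oppLR => /eqP.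
Qed.

Lemma smooth_xi (O : set M) : smooth_field O xi.
Proof. exact: smooth_field_sub (acm_xi_smooth acm). Qed.

(** The derivative of <xi, xi> = 1. *)
Lemma inner_A_xi q u : inner g q (A q u) (xi q) = 0.
Proof.
have sx := acm_xi_smooth acm.
have := dfun_inner lc u (openT : open [set: M]) (I : [set: M] q) sx sx.
have -> : (fun r => inner g r (xi r) (xi r) : R^o) = (fun=> 1).
  by apply/funext => r; rewrite inner_xi.
by rewrite dfun_cst (innerC g q (xi q)); lra.
Qed.

(** Anticommutation and phi xi = 0 put A xi in the kernel of phi, which is spanned by xi, while A xi
    is orthogonal to xi. *)
Lemma A_xi q : A q (xi q) = 0.
Proof.
have := anticomm q (xi q); rewrite phi_xi linear0 add0r => H.
have := phi2 q (A q (xi q)); rewrite H linear0 etaE inner_A_xi scale0r addr0.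
by move=> /esym/eqP; rewrite oppr_eq0 => /eqP.
Qed.

Lemma contact_distributionE q v :
  (v \in contact_distribution eta q) = (inner g q v (xi q) == 0).
Proof. by rewrite /contact_distribution memv_ker -etaE. Qed.

Lemma horizontal_part q v : inner g q (v - inner g q v (xi q) *: xi q) (xi q) = 0.
Proof. by rewrite innerBl innerZl inner_xi mulr1 subrr. Qed.

(** The hypothesis on D, tested against the horizontal part of the vector itself, shows that this
    part has norm zero. *)
Lemma cov_endomorphism_horizontal q u v : inner g q u (xi q) = 0 ->
  inner g q v (xi q) = 0 ->
  cov_endomorphism nabla phi q u v
  = inner g q (cov_endomorphism nabla phi q u v) (xi q) *: xi q.
Proof.
move=> u0 v0; set t := cov_endomorphism _ _ _ _ _.
pose z := t - inner g q t (xi q) *: xi q.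
have zD : inner g q z (xi q) = 0 := horizontal_part q t.
have tz : inner g q t z = 0.
  by apply: cov_phi_horizontal; rewrite contact_distributionE; apply/eqP.
apply/eqP; rewrite -subr_eq0 -/z; apply/eqP; apply: (inner_eq0 (g := g) (p := q)).
by rewrite {1}/z innerBl innerZl tz (innerC g q (xi q)) zD mulr0 subrr.
Qed.

(** * First and second derivatives of phi along horizontal fields *)

Section Horizontal.
Variables (O : set M) (V : M -> 'rV[R]_m).
Hypotheses (oO : open O) (sV : smooth_field O V)
  (V_xi : forall q, O q -> inner g q (V q) (xi q) = 0).
Let phiV q := phi q (V q).
Let sphiV : smooth_field O phiV := acm_phi_smooth acm oO sV.

(** This is (nabla_xi phi) V, expressed with the field V rather than through [cov_endomorphism] so
    that it is visibly a smooth field: [cov_cov_phi] differentiates a multiple of it. *)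
Definition cov_xi_phi q := nabla phiV q (xi q) - phi q (nabla V q (xi q)).

Lemma smooth_cov_xi_phi : smooth_field O cov_xi_phi.
Proof.
apply: smooth_fieldD => //; first exact: (smooth_cov nabla oO (smooth_xi O)).
apply: smooth_fieldN => //; apply: (acm_phi_smooth acm) => //.
exact: (smooth_cov nabla oO (smooth_xi O)).
Qed.

Lemma inner_cov_xi q u : O q -> inner g q (nabla V q u) (xi q) = - inner g q (V q) (A q u).
Proof.
move=> Oq; have := dfun_inner lc u oO Oq sV (smooth_xi O).
have E r : O r -> (0 : R^o) = inner g r (V r) (xi r) by move=> Or; rewrite V_xi.
rewrite (dfun_local oO Oq E (smooth_fun_cst 0 oO)) dfun_cst; lra.
Qed.

(** Split u into its horizontal part u' and a multiple of xi. In direction u' only a multiple of xi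
    appears; its coefficient comes from differentiating <phi V, xi> = 0, and A u' = A u because A xi
    = 0. *)
Lemma cov_phi q u : O q ->
  nabla phiV q u = phi q (nabla V q u)
    + (inner g q (V q) (phi q (A q u)) *: xi q + inner g q u (xi q) *: cov_xi_phi q).
Proof.
move=> Oq; pose L x := nabla phiV q x - phi q (nabla V q x).
have LD x y : L (x + y) = L x + L y.
  by rewrite /L !linearD /= addrACA.
have LZ k x : L (k *: x) = k *: L x.
  by rewrite /L !linearZ /= scalerDr.
pose u' := u - inner g q u (xi q) *: xi q.
have u'D : inner g q u' (xi q) = 0 := horizontal_part q u.
have Lu' : L u' = inner g q (V q) (phi q (A q u)) *: xi q.
  have LE : L u' = cov_endomorphism nabla phi q u' (V q).
    exact: (cov_endomorphism_field nabla u' (acm_phi_smooth acm) oO Oq sV).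
  rewrite LE (cov_endomorphism_horizontal u'D (V_xi Oq)) -LE; congr (_ *: _).
  rewrite /L innerBl inner_phi_xi subr0.
  have phiV_xi r : O r -> (0 : R^o) = inner g r (phiV r) (xi r).
    by move=> Or; rewrite inner_phi_xi.
  have := dfun_inner lc u' oO Oq sphiV (smooth_xi O).
  rewrite (dfun_local oO Oq phiV_xi (smooth_fun_cst 0 oO)) dfun_cst.
  have -> : A q u' = A q u by rewrite /u' linearB linearZ /= A_xi scaler0 subr0.
  by rewrite phi_skew; lra.
have -> : nabla phiV q u = phi q (nabla V q u) + L u by rewrite /L addrC subrK.
have -> : L u = L u' + inner g q u (xi q) *: L (xi q) by rewrite -LZ -LD /u' subrK.
by rewrite Lu'.
Qed.

End Horizontal.

Section AtPoint.
Variable p : M.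
Let O := chart_dom (chart_at p).
Let oO : open O := chart_dom_open _.
Let Op : O p := chart_atP p.
Let sE v : smooth_field O (tangent_extension p v) := smooth_tangent_extension p v.
Let sxi : smooth_field O xi := smooth_xi O.

Variable V : M -> 'rV[R]_m.
Hypotheses (sV : smooth_field O V)
  (V_xi : forall q, O q -> inner g q (V q) (xi q) = 0).

Lemma cov_cov_phi w x z : inner g p w (xi p) = 0 -> inner g p x (xi p) = 0 ->
  inner g p z (xi p) = 0 ->
  inner g p (nabla (fun q => nabla (fun r => phi r (V r)) q (tangent_extension p x q)) p w) z
  = inner g p (phi p (nabla (fun q => nabla V q (tangent_extension p x q)) p w)) z
    + inner g p (V p) (A p x) * inner g p (phi p (A p w)) z
    + inner g p (V p) (phi p (A p x)) * inner g p (A p w) z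
    + dfun (fun q => inner g q (tangent_extension p x q) (xi q) : R^o) p w
      * inner g p (cov_xi_phi V p) z.
Proof.
move=> wD xD zD.
pose U q := nabla V q (tangent_extension p x q).
have sU : smooth_field O U := smooth_cov nabla oO (sE x) sV.
pose h q : R^o := inner g q (U q) (xi q).
have sh : smooth_fun O h := smooth_inner g oO sU sxi.
pose N q := (h q : R) *: xi q.
have sN : smooth_field O N := smooth_fieldZ oO sh sxi.
(* [cov_phi] applies to horizontal fields, and nabla_x V need not be one. Its vertical part N is
   killed by phi, but nabla N contributes h(p) A w with h(p) = - <V, A x>; this is the origin of the
   term <V, A x> <phi A w, z>. *)
pose UD q := U q - N q.
have sUD : smooth_field O UD := smooth_fieldD oO sU (smooth_fieldN oO sN).
have UD_xi q : O q -> inner g q (UD q) (xi q) = 0 by move=> _; exact: horizontal_part.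
pose a q := phi q (A q (tangent_extension p x q)).
have sa : smooth_field O a := acm_phi_smooth acm oO (smooth_cov nabla oO (sE x) sxi).
pose f q : R^o := inner g q (V q) (a q).
have sf : smooth_fun O f := smooth_inner g oO sV sa.
(* Zero at p because x is horizontal, but its derivative along w need not be, and it multiplies
   (nabla_xi phi) V. Alternated in w and x, this derivative becomes d eta(w, x). *)
pose k q : R^o := inner g q (tangent_extension p x q) (xi q).
have sk : smooth_fun O k := smooth_inner g oO (sE x) sxi.
have sB : smooth_field O (cov_xi_phi V) := smooth_cov_xi_phi oO sV.
pose F1 q := phi q (UD q).
have sF1 : smooth_field O F1 := acm_phi_smooth acm oO sUD.
pose F2 q := (f q : R) *: xi q.
have sF2 : smooth_field O F2 := smooth_fieldZ oO sf sxi.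
pose F3 q := (k q : R) *: cov_xi_phi V q.
have sF3 : smooth_field O F3 := smooth_fieldZ oO sk sB.
have sF23 := smooth_fieldD oO sF2 sF3.
have E q : O q -> F1 q + (F2 q + F3 q)
    = nabla (fun r => phi r (V r)) q (tangent_extension p x q).
  move=> Oq; rewrite (cov_phi oO sV V_xi _ Oq) -/(a q) -/(f q); congr (_ + _).
  by rewrite /F1 /UD /N linearB linearZ /= phi_xi scaler0 subr0.
rewrite (cov_local nabla oO Op (smooth_fieldD oO sF1 sF23) E).
rewrite (cov_add nabla oO Op w sF1 sF23) (cov_add nabla oO Op w sF2 sF3).
rewrite (cov_scale nabla oO Op w sf sxi) (cov_scale nabla oO Op w sk sB).
rewrite (cov_phi oO sUD UD_xi w Op).
have -> : nabla UD p w = nabla U p w - nabla N p w := cov_sub nabla oO Op w sU sN.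
have -> : nabla N p w = dfun h p w *: xi p + (h p : R) *: A p w :=
  cov_scale nabla oO Op w sh sxi.
have hp : (h p : R) = - inner g p (V p) (A p x).
  by rewrite /h /U (inner_cov_xi oO sV V_xi _ Op) tangent_extension_id.
have kp : (k p : R) = 0 by rewrite /k tangent_extension_id.
have fp : (f p : R) = inner g p (V p) (phi p (A p x)).
  by rewrite /f /a tangent_extension_id.
have xz : inner g p (xi p) z = 0 by rewrite innerC.
have -> : phi p (nabla U p w - (dfun h p w *: xi p + (h p : R) *: A p w))
    = phi p (nabla U p w) - (h p : R) *: phi p (A p w).
  rewrite linearB /= linearD /= !linearZ /= phi_xi scaler0 add0r ?scalerN//.
rewrite -/U -/k wD hp kp fp; move: (cov_xi_phi V p) (cov_xi_phi UD p) => B B'.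
rewrite !innerDl innerNl !innerZl xz.
have K (y1 y2 y3 y4 y5 y6 y7 y8 y9 y10 y11 : R) : y1 - - y2 * y3 + (y4 * 0 + 0 * y5)
    + (y6 * 0 + y7 * y8 + (y9 * y10 + 0 * y11)) = y1 + y2 * y3 + y7 * y8 + y9 * y10.
  by ring.
exact: K.
Qed.

(* The Ricci identity for [phi], applied to [V]. *)
Lemma curvature_phi w x z : inner g p w (xi p) = 0 -> inner g p x (xi p) = 0 ->
  inner g p z (xi p) = 0 ->
  inner g p (curvature nabla p w x (phi p (V p))) z
    + inner g p (curvature nabla p w x (V p)) (phi p z)
  = inner g p (V p) (A p x) * inner g p (phi p (A p w)) z
    + inner g p (V p) (phi p (A p x)) * inner g p (A p w) z
    - inner g p (V p) (A p w) * inner g p (phi p (A p x)) z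
    - inner g p (V p) (phi p (A p w)) * inner g p (A p x) z
    + skew_part g p (A p) w x * inner g p (cov_xi_phi V p) z.
Proof.
move=> wD xD zD.
have sphiV : smooth_field O (fun q => phi q (V q)) := acm_phi_smooth acm oO sV.
rewrite -(second_cov_commutator_curvature nabla w x sphiV).
rewrite -(second_cov_commutator_curvature nabla w x sV).
have := (cov_cov_phi wD xD zD, cov_cov_phi xD wD zD).
move: (cov_xi_phi V p) => B [C1 C2].
rewrite /second_cov_commutator !innerBl C1 C2.
have E a b : dfun (fun q => inner g q (tangent_extension p a q) (xi q) : R^o) p b
   = inner g p (nabla (tangent_extension p a) p b) (xi p) + inner g p a (A p b).
  by rewrite (dfun_inner lc b oO Op (sE a) sxi) tangent_extension_id.
have S : nabla (tangent_extension p w) p x = nabla (tangent_extension p x) p w.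
  by have := cov_tangent_extension_sym lc w x Op; rewrite !tangent_extension_id.
rewrite (E x w) (E w x) S /skew_part !(phi_skew p (nabla _ p _)).
rewrite (innerC g p x) (innerC g p w).
ring.
Qed.

(** Differentiating eta(X) = <X, xi> gives a covariant derivative of the extension and a term in A;
    torsion-freeness cancels the former between the two directions. *)
Lemma exterior_derivativeE u v :
  exterior_derivative eta p u v = skew_part g p (A p) u v.
Proof.
rewrite /exterior_derivative lie_bracket_tangent_extension linear0 subr0.
have E a b : dfun (fun q => eta q (tangent_extension p a q)) p b
   = inner g p (nabla (tangent_extension p a) p b) (xi p) + inner g p a (A p b).
  have -> : (fun q => eta q (tangent_extension p a q))
      = (fun q => inner g q (tangent_extension p a q) (xi q) : R^o).
    by apply/funext => q; rewrite -etaE.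
  by rewrite (dfun_inner lc b oO Op (sE a) sxi) tangent_extension_id.
have S : nabla (tangent_extension p u) p v = nabla (tangent_extension p v) p u.
  by have := cov_tangent_extension_sym lc u v Op; rewrite !tangent_extension_id.
rewrite (E v u) (E u v) S /skew_part (innerC g p v) (innerC g p u (A p v)).
by rewrite opprD addrACA subrr add0r.
Qed.

End AtPoint.

End AlmostContact.

(** * The algebraic identity at p and the conclusion *)

Unset Implicit Arguments.

Theorem theorem1 (R : realType) (n : nat) (M : manifold R (2 * n + 1))
    (phi : M -> 'End('rV[R]_(2 * n + 1))) (xi : M -> 'rV[R]_(2 * n + 1))
    (eta : M -> 'Hom('rV[R]_(2 * n + 1), R^o)) (g : riemannian_metric M)
    (nabla : affine_connection M) (p : M) (c : R) :
  let A := nabla xi in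
  let D := contact_distribution eta in
  (1 <= n)%N ->
  contact_form n eta ->
  almost_contact_metric phi xi eta g ->
  levi_civita g nabla ->
  (forall (q : M) (v : 'rV[R]_(2 * n + 1)), A q (phi q v) + phi q (A q v) = 0) ->
  (forall (q : M) (u v w : 'rV[R]_(2 * n + 1)),
     u \in D q -> v \in D q -> w \in D q ->
     g q (cov_endomorphism nabla phi q u v) w = 0) ->
  (forall pi : {vspace 'rV[R]_(2 * n + 1)},
     \dim pi = 2%N -> (pi <= D p)%VS -> sectional_curvature g nabla p pi = c) ->
  (2 * n + 1 = 5)%N /\
  (((A p @: D p)%VS = D p /\ {in D p &, injective (A p)}) <-> c <> 0).
Proof.
move=> A D n1 [_ contact] acm lc anticomm hor sec.
have DE v : (v \in D p) = (inner g p v (xi p) == 0) := contact_distributionE acm p v.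
have DP v : v \in D p -> inner g p v (xi p) = 0 by rewrite DE => /eqP.
have J_D u : u \in D p -> phi p u \in D p.
  by rewrite !DE (inner_phi_xi acm).
have A_D u : u \in D p -> A p u \in D p.
  by rewrite !DE (inner_A_xi acm lc).
have JJ u : u \in D p -> phi p (phi p u) = - u.
  by move=> uD; rewrite (phi2 acm) (etaE acm) DP// scale0r addr0.
have ipJ u v : u \in D p -> v \in D p ->
    inner g p (phi p u) (phi p v) = inner g p u v.
  by move=> uD vD; rewrite (inner_phi acm) (etaE acm p u) DP// mul0r subr0.
have AJ u : u \in D p -> A p (phi p u) = - phi p (A p u).
  by move=> _; apply/eqP; rewrite -addr_eq0 anticomm.
have w_nondeg u : u \in D p ->
    (forall v, v \in D p -> skew_part g p (A p) u v = 0) -> u = 0.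
  move=> uD uw; apply: contrapT => /eqP u0.
  (* A takes values in D and A xi = 0, so d eta(u, xi) = 0 as well: u lies in the kernels of both
     eta and d eta, and the contact volume form would vanish at p. *)
  have Aeta v : skew_part g p (A p) u v = 0.
    have v'D : v - inner g p v (xi p) *: xi p \in D p.
      by rewrite DE (horizontal_part acm).
    have Av' : A p (v - inner g p v (xi p) *: xi p) = A p v.
      by rewrite linearB linearZ /= (A_xi acm lc anticomm) scaler0 subr0.
    have := uw _ v'D; rewrite /skew_part Av'.
    by rewrite innerBr innerZr (inner_A_xi acm lc) mulr0 subr0.
  have dE := exterior_derivativeE acm lc p.
  have [v /eqP] := contact p; apply.
  apply: (@degenerate_contact_eq0 R _ n (eta p) (exterior_derivative eta p) u v).
  - by rewrite addnC mulnC.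
  - by move=> k y z; rewrite linearP.
  - by move=> k y z t; rewrite !dE /skew_part linearP innerDl innerDr innerZl innerZr; ring.
  - by move=> k y z t; rewrite !dE /skew_part linearP innerDl innerDr innerZl innerZr; ring.
  - exact: u0.
  - by have := DP _ uD; rewrite -(etaE acm).
  - by move=> t; rewrite dE.
  - by move=> t; rewrite dE skew_partC Aeta oppr0.
pose O := chart_dom (chart_at p).
have oO : open O := chart_dom_open _.
have Op : O p := chart_atP p.
(* The horizontal projection of the coordinate extension: it is a section of D near p, not only at
   p, and keeps the value y when y is in D p. *)
pose V y q := tangent_extension p y q - inner g q (tangent_extension p y q) (xi q) *: xi q.
have sE y : smooth_field O (tangent_extension p y) := smooth_tangent_extension p y.
have sxi : smooth_field O xi := smooth_xi acm O.
have sV y : smooth_field O (V y) := smooth_fieldD oO (sE y)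
  (smooth_fieldN oO (smooth_fieldZ oO (smooth_inner g oO (sE y) sxi) sxi)).
have V_xi y q : O q -> inner g q (V y q) (xi q) = 0.
  by move=> _; exact: horizontal_part acm _ _.
have Vp y : y \in D p -> V y p = y.
  by move=> yD; rewrite /V tangent_extension_id DP// scale0r subr0.
have K := @constant_curvature R _ M g p (D p) c (curvature nabla p)
  (curvatureDl nabla p) (fun a b u w => curvatureDm nabla p u a b w)
  (fun a b u v => curvatureDr nabla p u v a b)
  (curvatureZm nabla p) (curvatureZr nabla p) (curvature_anti nabla p)
  (curvature_skew p lc) (curvature_bianchi p lc) sec.
(* Here b(Y, Z) is <(nabla_xi phi) V_Y, Z>. As phi preserves D p, the constant curvature formula [K]
   applies to both curvature terms of [curvature_phi]. *)
have wedge_id W X Y Z : W \in D p -> X \in D p -> Y \in D p -> Z \in D p ->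
    c * complex_wedge g p (phi p) (phi p W) X Y Z
    = - complex_wedge g p (phi p) (phi p (A p W)) (A p X) Y Z
      + skew_part g p (A p) W X * inner g p (cov_xi_phi phi xi nabla (V Y) p) Z.
  move=> WD XD YD ZD.
  have := curvature_phi acm lc anticomm hor (sV Y) (V_xi Y) (DP _ WD) (DP _ XD) (DP _ ZD).
  rewrite (Vp _ YD) !K ?J_D// -/A.
  rewrite (innerC g p Y (A p X)) (innerC g p Y (phi p (A p X))).
  rewrite (innerC g p Y (A p W)) (innerC g p Y (phi p (A p W))).
  rewrite /complex_wedge JJ// (JJ (A p W)) ?A_D// !innerNl.
  move: (inner g p (cov_xi_phi _ _ _ _ _) _) => b.
  rewrite !(phi_skew acm p W) !(phi_skew acm p X).
  rewrite !(phi_skew acm p (A p W)) !(phi_skew acm p (A p X)).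
  lra.
have dimD : \dim (D p) = (2 * n)%N.
  have xiD : eta p (xi p) != 0 by rewrite (acm_eta_xi acm) oner_eq0.
  by apply/succn_inj; rewrite (dim_lker_form xiD) addn1.
have D0 : (0 < \dim (D p))%N by rewrite dimD muln_gt0.
have Deven : ~~ odd (\dim (D p)) by rewrite dimD oddM.
have [D4 iso] := antilinear_identity_dim J_D A_D JJ ipJ AJ w_nondeg wedge_id D0 Deven.
by split=> //; rewrite -dimD D4.
Qed.
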